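(* Let $\Bbbk$ be a field of characteristic zero. For $k\ge1$, the element $p_k=m_k$ belongs to the center of $\Lambda$ if and only if $k$ is even.
   Context: The algebra of odd symmetric functions: let $\Lambda'$ be the free associative $\mathbb{Z}$-graded $\Bbbk$-algebra on $h_1,h_2,\dots$ with $\deg h_n=n$; set $h_0=1$, $h_n=0$ for $n<0$. For a composition $\alpha=(a_1,\dots,a_k)$ (finite sequence of positive integers) put $h_\alpha=h_{a_1}\cdots h_{a_k}$, $|\alpha|=a_1+\dots+a_k$, $S_\alpha=S_{a_1}\times\dots\times S_{a_k}\subset S_{|\alpha|}$. The symmetric bilinear form on $\Lambda'$ is $(h_\beta,h_\alpha)=\sum_{c\in S_\beta\backslash S_n/S_\alpha}(-1)^{\ell(c)}$ if $|\alpha|=|\beta|=n$, and $0$ if $|\alpha|\ne|\beta|$, where $\ell(c)$ is the Coxeter length of the minimal length element of $c$. Let $\mathcal I$ be the radical of the form (a two-sided ideal) and $\Lambda=\Lambda'/\mathcal I$, with the induced grading $\Lambda=\bigoplus_n\Lambda_n$, multiplication and (nondegenerate) form. The elements $h_\lambda$, $\lambda\vdash n$, form a basis of $\Lambda_n$. The odd monomial symmetric functions $\{m_\lambda\}_{\lambda\vdash n}$ are the dual basis: $(h_\lambda,m_\mu)=\delta_{\lambda\mu}$. For $n\ge1$, $m_n$ denotes $m_{(n)}$, and $p_n=m_n$ is called the $n$-th odd power symmetric function. The center is the usual (ungraded) center of the algebra $\Lambda$. *)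

(* Defs.v *)
From HB Require Import structures.
From mathcomp Require Import all_boot all_order all_fingroup all_algebra.
From mathcomp Require Import finmap monalg boolp.

Set Implicit Arguments.
Unset Strict Implicit.
Unset Printing Implicit Defensive.

Import GRing.Theory.
Local Open Scope ring_scope.
Local Open Scope quotient_scope.

(* ** Coxeter length and double cosets in the symmetric group *)

Definition simple_refl (n : nat) : {set 'S_n} :=
  [set tperm ij.1 ij.2 | ij : 'I_n * 'I_n & ij.2 == ij.1.+1 :> nat].

Lemma tperm_simple_word n (i j : 'I_n) :
  exists l, tperm i j \in (simple_refl n ^+ l)%g.
Proof.
have Hsucc d : forall i j : 'I_n, (j = i + d :> nat)%N ->
    exists l, tperm i j \in (simple_refl n ^+ l)%g.
  elim: d => [|d IHd] {}i {}j Eij.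
    have ->: j = i by apply: val_inj; rewrite /= Eij addn0.
    by exists 0%N; rewrite tperm1 expg0 inE.
  have ltk : (i + d < n)%N by have := ltn_ord j; rewrite Eij addnS; apply: ltnW.
  pose k := Ordinal ltk.
  have kj : tperm k j \in simple_refl n.
    by apply/imsetP; exists (k, j); rewrite ?inE //= Eij addnS.
  case: (posnP d) => [d0|d_gt0].
    exists 1%N; rewrite expg1; suff <- : k = i by [].
    by apply: val_inj; rewrite /= d0 addn0.
  have [l Hl] := IHd i k erefl.
  exists (1 + l + 1)%N; rewrite !expgD expg1.
  have ->: tperm i j = (tperm k j * tperm i k * tperm k j)%g.
    rewrite -[X in (X * _ * _)%g]tpermV -mulgA -conjgE tpermJ tpermL tpermD //.
      by apply/eqP => /(congr1 val) /= /eqP; rewrite -{2}[val i]addn0 eqn_add2l eqn0Ngt d_gt0.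
    by apply/eqP => /(congr1 val) /= /eqP; rewrite Eij -{2}[val i]addn0 eqn_add2l.
  by rewrite !mem_mulg.
case: (leqP i j) => [le_ij|/ltnW le_ji].
  by apply: (Hsucc (j - i)%N); rewrite subnKC.
by rewrite tpermC; apply: (Hsucc (i - j)%N); rewrite subnKC.
Qed.

Lemma simple_word n (w : 'S_n) : exists l, w \in (simple_refl n ^+ l)%g.
Proof.
have [ts -> _] := prod_tpermP w.
elim: ts => [|t ts [l Hl]]; first by exists 0%N; rewrite big_nil expg0 inE.
have [l' Hl'] := tperm_simple_word t.1 t.2.
by exists (l' + l)%N; rewrite big_cons expgD mem_mulg.
Qed.

Definition cox_length (n : nat) (w : 'S_n) : nat := ex_minn (simple_word w).

(* [young n [:: a_1; ...; a_k]] is S_{a_1} x ... x S_{a_k}: the permutations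
   preserving each of the consecutive blocks of sizes a_1, ..., a_k. *)
Definition young (n : nat) (alpha : seq nat) : {set 'S_n} :=
  [set s : 'S_n |
    [forall i, reshape_index alpha (s i) == reshape_index alpha i]].

Definition double_cosets (n : nat) (beta alpha : seq nat) : {set {set 'S_n}} :=
  [set (young n beta :* w * young n alpha)%g | w : 'S_n].

Definition double_coset_length (n : nat) (c : {set 'S_n}) : nat :=
  cox_length [arg min_(w < repr c in c) cox_length w].

(* ** The free algebra and its bilinear form *)

(* The letter i : nat stands for the generator h_{i+1}. *)
Notation free_odd_sym K := {malg K[{fmonom nat}]}.

Definition comp_of_word (u : {fmonom nat}) : seq nat := [seq i.+1 | i <- u].

Section OddSym.
Variable K : fieldType.
Local Notation L' := (free_odd_sym K).

Definition h (n : nat) : L' := if n is i.+1 then << fmu i >> else 1.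

Definition h_comp (alpha : seq nat) : L' := \prod_(a <- alpha) h a.

Definition hform (beta alpha : seq nat) : K :=
  if sumn beta == sumn alpha then
    \sum_(c in double_cosets (sumn alpha) beta alpha)
      (-1) ^+ double_coset_length c
  else 0.

Definition form (f g : L') : K :=
  \sum_(u <- msupp f) \sum_(v <- msupp g)
    f@_u * g@_v * hform (comp_of_word u) (comp_of_word v).

Definition homog (n : nat) (f : L') : Prop :=
  forall u, u \in msupp f -> sumn (comp_of_word u) = n.

Definition radical : {pred L'} := fun f => `[< forall g, form f g = 0 >].

Lemma formE f g : form f g = mmap idfun (fun u =>
  \sum_(v <- msupp g) g@_v * hform (comp_of_word u) (comp_of_word v)) f.
Proof.
rewrite /form mmapE; apply: eq_bigr => u _; rewrite big_distrr /=.
by apply: eq_bigr => v _; rewrite mulrA.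
Qed.

Lemma radical_zmod_closed : zmod_closed radical.
Proof.
split=> [|x y /asboolP x0 /asboolP y0]; apply/asboolP => g.
  by rewrite /form msupp0 big_seq_fset0.
by rewrite formE raddfB /= -!formE x0 y0 subrr.
Qed.

HB.instance Definition _ := GRing.isZmodClosed.Build L' radical
  radical_zmod_closed.

(* The radical is a two-sided ideal, so the multiplication and the form of the
   free algebra descend to the quotient; [lift_op2] and [lift_fun2] compute the
   descended operations on representatives.  MathComp's ring quotients require
   a commutative base ring. *)
Definition odd_sym := {ideal_quot radical}.

Definition mulL : odd_sym -> odd_sym -> odd_sym := lift_op2 odd_sym *%R.

Definition formL : odd_sym -> odd_sym -> K := lift_fun2 odd_sym form.

Definition homogL (n : nat) (x : odd_sym) : Prop :=
  exists2 f : L', homog n f & x = \pi_odd_sym f.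

Definition hL (alpha : seq nat) : odd_sym := \pi_odd_sym (h_comp alpha).

Definition centralL (x : odd_sym) : Prop :=
  forall y : odd_sym, mulL x y = mulL y x.

End OddSym.

(* ** Odd monomial symmetric functions *)

Definition is_part (n : nat) (lambda : seq nat) : bool :=
  [&& sorted geq lambda, 0%N \notin lambda & sumn lambda == n].

(* [m] restricted to the partitions of n is the basis of degree n dual to
   (h_lambda), for every n; values of [m] off partitions are irrelevant. *)
Definition is_dual_basis (K : fieldType) (m : seq nat -> odd_sym K) : Prop :=
  forall (n : nat) (mu : seq nat), is_part n mu ->
    homogL n (m mu) /\
    forall lambda : seq nat, is_part n lambda ->
      formL (hL K lambda) (m mu) = (lambda == mu)%:R.

(* Main.v *)
(* Recording how a permutation distributes the blocks of beta over the blocks of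
   alpha turns a double coset into a nonnegative integer matrix A with margins
   (beta, alpha), and the minimal length in the coset is the number
   sum_{i<i', j>j'} A_ij A_i'j' of inversions forced by A.  Cutting such a matrix
   horizontally shows that the form is adjoint to the super-coproduct
   h_n |-> sum_i h_i (x) h_(n-i); in particular its radical is an ideal.

   Matrices with two rows give the relations h_i h_j = h_j h_i (i + j even) and
   h_i h_j + (-1)^i h_j h_i = (-1)^i h_(i+1) h_(j-1) + h_(j-1) h_(i+1) (i + j odd).
   When k is even, straightening with them never turns a product of at least two
   generators into h_k, so m_k is primitive; as its degree is even, no signs occur
   in the coproduct formula and m_k is central.  When k is odd, pairing
   m_k h_1 and h_1 m_k (for k = 1: h_1 h_2 and h_2 h_1) with h_k h_1
   (for k = 1: h_2 h_1) gives values that differ by 2. *)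

Require Import Defs.
From mathcomp Require Import all_boot all_order all_algebra.
From mathcomp Require Import all_fingroup finmap monalg boolp zify ring.

Set Implicit Arguments.
Unset Strict Implicit.
Unset Printing Implicit Defensive.

Import GRing.Theory.
Local Open Scope nat_scope.

(** * Inversions and Coxeter length *)

Section Inversions.
Variable n : nat.
Implicit Types (w : 'S_n) (x y i j : 'I_n).

Definition invset w : {set 'I_n * 'I_n} :=
  [set p : 'I_n * 'I_n | (p.1 < p.2) && (w p.2 < w p.1)].

Definition ninv w : nat := #|invset w|.

(** No position lies strictly between [i] and [j], so this is the only pair whose order can
    change. *)
Lemma tperm_adj_lt i j x y : j = i.+1 :> nat -> x < y ->
  (x, y) != (i, j) -> tperm i j x < tperm i j y.
Proof.
move=> Ej ltxy; rewrite xpair_eqE -!val_eqE /=.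
have vne (u v : 'I_n) : u <> v -> u <> v :> nat by move=> H /val_inj.
have veq (u v : 'I_n) : u = v -> u = v :> nat by move->.
case: (tpermP i j x) => [/veq Ex|/veq Ex|/vne nxi /vne nxj];
  case: (tpermP i j y) => [/veq Ey|/veq Ey|/vne nyi /vne nyj];
  lia.
Qed.

(** [tperm i j], acting on pairs of positions, carries the inversions of [w] onto those of
    [tperm i j * w] other than [(i, j)], which is new. *)
Lemma ninv_ascent w i j : j = i.+1 :> nat -> w i < w j ->
  ninv (tperm i j * w)%g = (ninv w).+1.
Proof.
move=> Ej ltw; pose t := tperm i j.
pose phi (p : 'I_n * 'I_n) := (t p.1, t p.2).
have phiK : involutive phi by case=> x y; rewrite /phi /= !tpermK.
have memphi p : (p \in phi @: invset w) = (phi p \in invset w).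
  by rewrite -{1}[p]phiK mem_imset //; apply: inv_inj.
have E : invset (t * w)%g = (i, j) |: phi @: invset w.
  apply/setP=> -[x y]; rewrite !inE /= !permM.
  rewrite memphi inE /=; case: eqP => [[-> ->]|/eqP ne] /=.
    by rewrite tpermL tpermR ltw Ej leqnn.
  case: ltnP => [ltxy|leyx] /=; first by rewrite (tperm_adj_lt Ej ltxy ne).
  symmetry; apply/negP => /andP[ltt ltwt].
  have [Et|ne'] := eqVneq (t x, t y) (i, j).
    by case: Et ltwt => -> ->; lia.
  by have := tperm_adj_lt Ej ltt ne'; rewrite !tpermK ltnNge leyx.
rewrite /ninv E cardsU1 card_imset; last exact: inv_inj.
by rewrite memphi inE /phi /= tpermL tpermR Ej ltnNge leqnSn.
Qed.

Lemma ninv_descent w i j : j = i.+1 :> nat -> w j < w i ->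
  ninv w = (ninv (tperm i j * w)%g).+1.
Proof.
move=> Ej ltw; rewrite -(ninv_ascent Ej).
  by rewrite mulgA tperm2 mul1g.
by rewrite !permM tpermL tpermR.
Qed.

(** Only adjacent pairs within the interval from [x] to [y] are tested, so that the lemma applies
    inside a single block. *)
Lemma ascents_lt w x y : x < y ->
  (forall i j, j = i.+1 :> nat -> x <= i -> j <= y -> w i < w j) -> w x < w y.
Proof.
move=> ltxy; have [d Ed] : exists d, y = x + d.+1 :> nat by exists (y - x).-1; lia.
elim: d x y ltxy Ed => [|d IHd] x y ltxy Ed H; first by apply: H; lia.
have ltz : x + d.+1 < n by have := ltn_ord y; lia.
pose z := Ordinal ltz.
apply: (@ltn_trans (w z)).
  by apply: IHd => //=; [lia | move=> i j Ej lei lej; apply: H => //;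
      rewrite /= in lej; lia].
by apply: H => //=; lia.
Qed.

Lemma ltn_id_perm w : {homo w : x y / x < y} -> forall x, x <= w x.
Proof.
move=> Hw x; have [k] := ubnP (nat_of_ord x); elim: k x => // k IHk x ltx.
case: (posnP x) => [-> //|x_gt0].
have ltp : x.-1 < n by have := ltn_ord x; lia.
have := IHk (Ordinal ltp); have := Hw (Ordinal ltp) x; rewrite /=; lia.
Qed.

Lemma ninvV w : ninv w^-1 = ninv w.
Proof.
rewrite /ninv -(@card_imset _ _ (fun p => (w p.2, w p.1)) (invset w)).
  congr #|pred_of_set _|; apply/setP => -[x y]; rewrite inE /=.
  apply/andP/imsetP => [[ltxy ltw]|[[a b]]].
    by exists ((w^-1)%g y, (w^-1)%g x); rewrite ?inE /= ?permKV ?ltxy ?ltw.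
  by rewrite inE /= => /andP[ltab ltw] [-> ->]; rewrite !permK.
by move=> [a b] [c d] /= [/perm_inj -> /perm_inj ->].
Qed.

Lemma ninv_word l w : w \in (simple_refl n ^+ l)%g -> ninv w <= l.
Proof.
elim: l w => [|l IHl] w.
  rewrite expg0 inE => /eqP ->; rewrite leqn0 /ninv cards_eq0; apply/eqP/setP => -[x y].
  by rewrite !inE !perm1 /=; case: ltngtP.
rewrite expgS => /mulsgP[s u /imsetP[[i j]]]; rewrite inE /= => /eqP Ej -> /IHl leu -> /=.
case: (ltngtP (u i) (u j)) => [lt|lt|/val_inj/perm_inj Eij].
- by rewrite (ninv_ascent Ej).
- by move: leu; rewrite (ninv_descent Ej lt) => /ltnW/leqW.
- by move: Ej; rewrite Eij; lia.
Qed.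

(** Descents are removed one by one; without descents both [w] and its inverse are increasing, which
    forces [w = 1]. *)
Lemma word_ninv w : w \in (simple_refl n ^+ ninv w)%g.
Proof.
have [k] := ubnP (ninv w); elim: k w => // k IHk w ltk.
have [/existsP[[i j]] /andP[/eqP Ej ltw]|/existsPn noD] :=
  boolP [exists p : 'I_n * 'I_n, (p.2 == p.1.+1 :> nat) && (w p.2 < w p.1)].
  rewrite /= in Ej ltw; have Ew := ninv_descent Ej ltw.
  rewrite Ew expgS -[w in X in X \in _](mul1g w) -(tperm2 i j) -mulgA.
  apply: mem_mulg; first by apply/imsetP; exists (i, j); rewrite ?inE //= Ej.
  by apply: IHk; rewrite -ltnS -Ew.
have Hw : {homo w : x y / x < y}.
  move=> x y ltxy; apply: ascents_lt => // i j Ej _ _.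
  have := noD (i, j); rewrite /= Ej eqxx /=.
  case: ltngtP => // /val_inj/perm_inj Eij; move: Ej; rewrite Eij; lia.
have HwV : {homo (w^-1)%g : x y / x < y}.
  move=> x y ltxy; case: (ltngtP ((w^-1)%g x) ((w^-1)%g y)) => //
      [/Hw|/val_inj/perm_inj Exy].
    by rewrite !permKV; lia.
  by move: ltxy; rewrite Exy ltnn.
have w1 : w = 1%g.
  apply/permP => x; rewrite perm1; apply: val_inj; apply/eqP.
  rewrite eqn_leq /= (ltn_id_perm Hw) andbT.
  by have := ltn_id_perm HwV (w x); rewrite permK.
have -> : ninv w = 0.
  apply/eqP; rewrite cards_eq0; apply/eqP/setP => -[x y].
  by rewrite w1 !inE !perm1 /=; case: ltngtP.
by rewrite expg0 w1 inE.
Qed.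

Lemma cox_lengthE w : cox_length w = ninv w.
Proof.
rewrite /cox_length; case: ex_minnP => l Hl Hmin.
by apply/eqP; rewrite eqn_leq ninv_word // Hmin // word_ninv.
Qed.

End Inversions.

(** * Minimal length in a double coset *)

Lemma reshape_index_mono sh i j :
  i <= j -> reshape_index sh i <= reshape_index sh j.
Proof.
rewrite /reshape_index => leij; have : i.+1 <= j.+1 by [].
elim: sh i.+1 j.+1 {leij} => //= a sh IHsh {}i {}j leij.
case: eqP => // /eqP ne; case: eqP => [E|_]; first by move: ne E; lia.
by rewrite ltnS IHsh // leq_sub2r.
Qed.

Section DoubleCosets.
Variables (n : nat) (beta alpha : seq nat).
Implicit Types (w s t : 'S_n).
Local Notation f := (reshape_index beta).
Local Notation g := (reshape_index alpha).

(** These pairs are inversions of [w], since block indices are monotone in the position; their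
    number depends only on the double coset. *)
Definition cross_inv w : nat :=
  #|[set p : 'I_n * 'I_n | (f p.1 < f p.2) && (g (w p.2) < g (w p.1))]|.

Lemma youngP gamma s :
  reflect (forall i, reshape_index gamma (s i) = reshape_index gamma i)
          (s \in young n gamma).
Proof. by rewrite inE; apply: (iffP forallP) => H i; apply/eqP; apply: H. Qed.

Lemma tperm_young gamma (i j : 'I_n) :
  reshape_index gamma i = reshape_index gamma j -> tperm i j \in young n gamma.
Proof. by move=> E; apply/youngP => x; case: tpermP => [->|->|]. Qed.

Lemma youngV gamma s : s \in young n gamma -> (s^-1)%g \in young n gamma.
Proof. by move/youngP => H; apply/youngP => x; rewrite -H permKV. Qed.

Lemma youngM gamma s t :
  s \in young n gamma -> t \in young n gamma -> (s * t)%g \in young n gamma.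
Proof. by move=> /youngP H /youngP H'; apply/youngP => x; rewrite permM H' H. Qed.

Lemma young1 gamma : 1%g \in young n gamma.
Proof. by apply/youngP => x; rewrite perm1. Qed.

Lemma dcosetP w u :
  reflect (exists s t, [/\ s \in young n beta, t \in young n alpha & u = s * w * t]%g)
          (u \in (young n beta :* w * young n alpha)%g).
Proof.
apply: (iffP mulsgP) => [[sw t /rcosetP[s Hs ->] Ht ->]|[s [t [Hs Ht ->]]]].
  by exists s, t.
by exists (s * w)%g t => //; apply/rcosetP; exists s.
Qed.

Lemma dcoset_refl w : w \in (young n beta :* w * young n alpha)%g.
Proof. by apply/dcosetP; exists 1%g, 1%g; rewrite !young1 mul1g mulg1. Qed.

Lemma cross_inv_dcoset w s t : s \in young n beta -> t \in young n alpha ->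
  cross_inv (s * w * t)%g = cross_inv w.
Proof.
move=> /youngP Hs /youngP Ht; rewrite /cross_inv.
pose phi (p : 'I_n * 'I_n) := (s p.1, s p.2).
have phi_inj : injective phi by move=> [a b] [c d] /= [/perm_inj -> /perm_inj ->].
rewrite -[LHS](card_imset _ phi_inj); congr #|pred_of_set _|.
apply/setP => -[x y]; rewrite -[x](permKV s) -[y](permKV s) (mem_imset _ (_, _) phi_inj).
by rewrite !inE /= !permM !Ht !Hs.
Qed.

(* A descent of w inside a block of beta, or of w^-1 inside a block of alpha, could
   be removed by a simple reflection without leaving the double coset. *)
Lemma ninv_min w :
  (forall u, u \in (young n beta :* w * young n alpha)%g -> ninv w <= ninv u) ->
  ninv w = cross_inv w.
Proof.
move=> Hmin.
have ascf (x y : 'I_n) : x < y -> f x = f y -> w x < w y.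
  move=> ltxy Exy; apply: ascents_lt => // i j Ej lei lej.
  case: (ltngtP (w i) (w j)) => // [lt|/val_inj/perm_inj Eij]; last by move: Ej;
      rewrite Eij; lia.
  have Eij : f i = f j.
    have := reshape_index_mono beta lei; have := reshape_index_mono beta lej.
    have /(reshape_index_mono beta) : i <= j by lia.
    lia.
  have mem : (tperm i j * w)%g \in (young n beta :* w * young n alpha)%g.
    by apply/dcosetP; exists (tperm i j), 1%g; rewrite tperm_young // young1 mulg1.
  by have := Hmin _ mem; rewrite (ninv_descent Ej lt) ltnn.
have ascg (x y : 'I_n) : x < y -> g x = g y -> (w^-1)%g x < (w^-1)%g y.
  move=> ltxy Exy; apply: ascents_lt => // i j Ej lei lej.
  case: (ltngtP ((w^-1)%g i) ((w^-1)%g j)) => // [lt|/val_inj/perm_inj Eij];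
      last by move: Ej; rewrite Eij; lia.
  have Eij : g i = g j.
    have := reshape_index_mono alpha lei; have := reshape_index_mono alpha lej.
    have /(reshape_index_mono alpha) : i <= j by lia.
    lia.
  have mem : (w * tperm i j)%g \in (young n beta :* w * young n alpha)%g.
    by apply/dcosetP; exists 1%g, (tperm i j); rewrite tperm_young // young1 mul1g.
  have := Hmin _ mem.
  by rewrite -[ninv w]ninvV -[ninv (w * _)%g]ninvV invMg tpermV (ninv_descent Ej lt) ltnn.
congr #|pred_of_set _|; apply/setP => -[x y]; rewrite !inE /=.
apply/andP/andP => -[]; last first.
  rewrite !ltnNge => lt1 lt2; split; apply/negP.
    by move/(reshape_index_mono beta); apply/negP.
  by move/(reshape_index_mono alpha); apply/negP.
move=> ltxy ltw; split; rewrite ltn_neqAle reshape_index_mono ?(ltnW ltxy) ?(ltnW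
    ltw) // andbT; apply/eqP => E.
  by have := ascf _ _ ltxy E; lia.
by have := ascg _ _ ltw E; rewrite !permK; lia.
Qed.

(** The minimum selected by [arg min] falls under [ninv_min]; as [cross_inv] is constant on the
    coset, any representative [w] computes it. *)
Lemma double_coset_lengthE c w :
  c \in double_cosets n beta alpha -> w \in c -> double_coset_length c = cross_inv w.
Proof.
case/imsetP => w0 _ ->; set c0 := (_ * _)%g.
have trans u v : u \in c0 -> v \in c0 -> v \in (young n beta :* u * young n alpha)%g.
  move=> /dcosetP[s [t [Hs Ht ->]]] /dcosetP[s' [t' [Hs' Ht' ->]]].
  apply/dcosetP; exists (s' * s^-1)%g, (t^-1 * t')%g.
  by rewrite !youngM ?youngV // !mulgA mulgKV mulgK.
move=> wc; rewrite /double_coset_length.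
case: arg_minnP => [|u uc Hmin]; first exact: mem_repr (dcoset_refl w0).
rewrite cox_lengthE ninv_min => [|v /dcosetP[s [t [Hs Ht Ev]]]].
  have /dcosetP[s [t [Hs Ht ->]]] := trans _ _ uc wc.
  by rewrite cross_inv_dcoset.
rewrite -!cox_lengthE; apply: Hmin.
case/dcosetP: uc => s' [t' [Hs' Ht' Eu]].
apply/dcosetP; exists (s * s')%g, (t' * t)%g.
by rewrite !youngM // Ev Eu !mulgA.
Qed.

End DoubleCosets.

(** * Matrices with prescribed margins *)

(** The pairs of vectors with sum [g]: they index the terms of the coproduct of h_g. *)
Fixpoint splits (g : seq nat) : seq (seq nat * seq nat) :=
  if g is a :: g' then
    [seq (i :: p.1, a - i :: p.2) | i <- iota 0 a.+1, p <- splits g']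
  else [:: ([::], [::])].

(* For x written as a row above y: the sum of x_p * y_q over q < p. *)
Fixpoint cross (x y : seq nat) : nat :=
  match x, y with
  | a :: x', b :: y' => b * sumn x' + cross x' y'
  | _, _ => 0
  end.

Definition addv (x y : seq nat) : seq nat := [seq p.1 + p.2 | p <- zip x y].

(** The explicit width [c] gives the matrix without rows a column sum of the right length. *)
Definition colsum c (A : seq (seq nat)) : seq nat := foldr addv (nseq c 0) A.

(** Built from the top row down: after the row [p.1] is chosen, [p.2] is the vector of column sums
    left for the other rows. *)
Fixpoint margin_mats (b g : seq nat) : seq (seq (seq nat)) :=
  if b is b0 :: b' then
    [seq p.1 :: A | p <- [seq p <- splits g | sumn p.1 == b0], A <- margin_mats b' p.2]
  else if all (pred1 0) g then [:: [::]] else [::].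

Fixpoint mat_inv c (A : seq (seq nat)) : nat :=
  if A is x :: A' then cross x (colsum c A') + mat_inv c A' else 0.

Lemma splits_cons a g : splits (a :: g) =
  [seq (i :: p.1, a - i :: p.2) | i <- iota 0 a.+1, p <- splits g].
Proof. by []. Qed.

Lemma mem_splits g p :
  (p \in splits g) = (size p.1 == size p.2) && (addv p.1 p.2 == g).
Proof.
elim: g p => [|a g IHg] [x y].
  by case: x y => [|i x] [|j y]; rewrite inE /= ?andbF.
rewrite splits_cons; apply/allpairsP/andP => [[[i q]]|[]].
  rewrite mem_iota IHg => /= -[lti /andP[/eqP E1 /eqP E2] [-> ->]] /=.
  by rewrite E1 eqxx /addv /= -/(addv _ _) E2 subnKC //; lia.
case: x y => [|i x] [|j y] //=; rewrite eqSS => /eqP Es /eqP[Ea Eg].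
exists (i, (x, y)); split; rewrite /= ?IHg ?Es -?Ea -?Eg ?eqxx ?addKn //.
by rewrite -/(iota 0 (i + j).+1) mem_iota /= ltnS leq_addr.
Qed.

Lemma splits_uniq g : uniq (splits g).
Proof.
elim: g => [|a g IHg] //; rewrite splits_cons.
apply: (allpairs_uniq (iota_uniq 0 a.+1) IHg) => -[i [x y]] [j [x' y']] _ _ /=.
by case=> -> -> _ ->.
Qed.

Lemma size_splits g p : p \in splits g -> size p.1 = size g /\ size p.2 = size g.
Proof.
rewrite mem_splits => /andP[/eqP Es /eqP <-].
by rewrite size_map size_zip Es minnn.
Qed.

Lemma size_colsum c A : all (fun x => size x == c) A -> size (colsum c A) = c.
Proof.
elim: A => [|x A IHA] /=; first by rewrite size_nseq.
by case/andP=> /eqP Ex /IHA EA; rewrite size_map size_zip EA Ex minnn.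
Qed.

Lemma mem_margin_mats b g A :
  (A \in margin_mats b g) = [&& [seq sumn x | x <- A] == b,
    all (fun x => size x == size g) A & colsum (size g) A == g].
Proof.
elim: b g A => [|b0 b IHb] g A /=.
  case: A => [|x A] /=; last by case: ifP; rewrite inE.
  case: all_pred1P => [E|ne]; first by rewrite inE /= -E !eqxx.
  by apply/esym/eqP => E; apply: ne.
apply/allpairsPdep/idP => [[p [A' []]]|].
  rewrite mem_filter => /andP[/eqP Eb pin]; rewrite IHb => /and3P[/eqP EA Hs /eqP Ec] ->.
  have [s1 s2] := size_splits pin; rewrite mem_splits in pin.
  case/andP: pin => _ /eqP Eg.
  by rewrite /= Eb EA eqxx s1 eqxx /= -{1}s2 Hs -{1}s2 Ec Eg eqxx.
case: A => [|x A] //= /and3P[/eqP[Eb EA] /andP[/eqP Ex HA] /eqP Eg].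
have sc := size_colsum HA.
exists (x, colsum (size g) A), A; split=> //.
  by rewrite mem_filter mem_splits /= Eb eqxx Ex sc eqxx Eg eqxx.
by rewrite IHb EA eqxx /= sc HA eqxx.
Qed.

(** The splitting used at each row can be read off the matrix: its second vector is the column sum
    of the rows below. *)
Lemma margin_mats_uniq b g : uniq (margin_mats b g).
Proof.
elim: b g => [|b0 b IHb] g /=; first by case: ifP.
apply: allpairs_uniq_dep => [|p _|u u']; [exact: filter_uniq (splits_uniq _) | exact:
    IHb |].
case/allpairsPdep => [[x y] [B [pin Bin ->]]] /allpairsPdep[[x' y'] [B' [pin' Bin'
    ->]]] /= [Ex EB].
rewrite -{}EB -{}Ex in pin' Bin' *; move: pin pin' Bin Bin'.
rewrite !mem_filter => /andP[_ pin] /andP[_ pin'].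
have [s0 s] := size_splits pin; have [s0' s'] := size_splits pin'; rewrite /= in s s'.
by rewrite !mem_margin_mats /= s s' => /and3P[_ _ /eqP <-] /and3P[_ _ /eqP <-].
Qed.

Lemma nth_addv x y j : size x = size y -> nth 0 (addv x y) j = nth 0 x j + nth 0 y j.
Proof. by elim: x y j => [|a x IHx] [|b y] [|j] //= [/IHx]; apply. Qed.

Lemma nth_colsum c A j : all (fun x => size x == c) A ->
  nth 0 (colsum c A) j = \sum_(x <- A) nth 0 x j.
Proof.
elim: A => [|x A IHA] /=; first by rewrite big_nil nth_nseq if_same.
by case/andP=> /eqP Ex HA; rewrite big_cons nth_addv ?IHA ?size_colsum.
Qed.

Lemma sumn_addv x y : size x = size y -> sumn (addv x y) = sumn x + sumn y.
Proof.
by elim: x y => [|a x IHx] [|b y] //= [/IHx E]; rewrite /addv /= -/(addv _ _) E addnACA.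
Qed.

Lemma sumn_splits g p : p \in splits g -> sumn p.1 + sumn p.2 = sumn g.
Proof. by rewrite mem_splits => /andP[/eqP Es /eqP <-]; rewrite sumn_addv. Qed.

Lemma margin_mats_sumn b g A : A \in margin_mats b g -> sumn b = sumn g.
Proof.
elim: b g A => [|b0 b IHb] g A /=.
  by case: ifP => // /all_pred1P ->; rewrite sumn_nseq mul0n.
case/allpairsPdep => p [A' []]; rewrite mem_filter => /andP[/eqP <- pin] /IHb -> _.
exact: sumn_splits pin.
Qed.

Lemma cross_addvr x y z : size x = size y -> size y = size z ->
  cross x (addv y z) = cross x y + cross x z.
Proof.
elim: x y z => [|a x IHx] [|b y] [|d z] //= [E1] [E2].
by rewrite -/(addv y z) IHx // mulnDl addnACA.
Qed.

Lemma cross_addvl x y z : size x = size y -> size y = size z ->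
  cross (addv x y) z = cross x z + cross y z.
Proof.
elim: x y z => [|a x IHx] [|b y] [|d z] //= [E1] [E2].
by rewrite -/(addv x y) IHx // sumn_addv // mulnDr addnACA.
Qed.

Lemma cross_nseq0r x c : cross x (nseq c 0) = 0.
Proof. by elim: x c => [|a x IHx] [|c] //=; rewrite IHx. Qed.

Lemma cross_nseq0l x c : cross (nseq c 0) x = 0.
Proof. by elim: x c => [|a x IHx] [|c] //=; rewrite IHx sumn_nseq muln0. Qed.

Lemma cross_colsum c x A : size x = c -> all (fun x => size x == c) A ->
  cross x (colsum c A) = \sum_(y <- A) cross x y.
Proof.
move=> Ex; elim: A => [|y A IHA] /=; first by rewrite big_nil cross_nseq0r.
by case/andP=> /eqP Ey HA; rewrite big_cons cross_addvr ?IHA ?size_colsum ?Ex.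
Qed.

Lemma crossE c x y : size x = c -> size y = c ->
  cross x y = \sum_(i < c) \sum_(j < c | j < i) nth 0 x i * nth 0 y j.
Proof.
elim: c x y => [|c IHc] [|a x] [|b y] //=; first by rewrite big_ord0.
move=> [Ex] [Ey]; rewrite big_ord_recl /= big_pred0 // add0n (IHc x y) //.
rewrite [in RHS](eq_bigr (fun i : 'I_c => nth 0 x i * b + \sum_(j < c | j < i) nth 0
    x i * nth 0 y j)).
  by rewrite big_split /= -big_distrl /= mulnC sumnE (big_nth 0) big_mkord Ex.
by move=> i _; rewrite big_mkcond big_ord_recl /= -big_mkcond.
Qed.

Lemma mat_invE c A : all (fun x => size x == c) A ->
  mat_inv c A = \sum_(i < size A) \sum_(j < size A | i < j) cross (nth [::] A i) (nth
      [::] A j).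
Proof.
elim: A => [|x A IHA] /=; first by rewrite big_ord0.
case/andP=> /eqP Ex HA; rewrite big_ord_recl cross_colsum // IHA //; congr (_ + _).
  by rewrite [RHS]big_mkcond [RHS]big_ord_recl /= add0n (big_nth [::]) big_mkord.
by apply: eq_bigr => i _; rewrite [RHS]big_mkcond big_ord_recl /= -big_mkcond.
Qed.

(** * Counting positions by block *)

Lemma map_reshape_index sh :
  [seq reshape_index sh k | k <- iota 0 (sumn sh)] =
  flatten (mkseq (fun i => nseq (nth 0 sh i) i) (size sh)).
Proof.
set ss := mkseq _ _.
have shE : shape ss = sh.
  by rewrite /shape -map_comp -[RHS](mkseq_nth 0); apply: eq_map => i;
      rewrite /= size_nseq.
apply: (@eq_from_nth _ 0); first by rewrite size_map size_iota size_flatten shE.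
move=> k; rewrite size_map size_iota => ltk.
rewrite (nth_map 0) ?size_iota // nth_iota //
    nth_flatten shE nth_mkseq ?reshape_indexP //.
by rewrite nth_nseq reshape_offsetP.
Qed.

Lemma count_reshape_index sh i :
  \sum_(k < sumn sh) (reshape_index sh k == i) = nth 0 sh i.
Proof.
have iotaE m : iota 0 m = index_iota 0 m by rewrite /index_iota subn0.
rewrite -(big_mkord xpredT (fun k => (reshape_index sh k == i) : nat)) -iotaE.
rewrite -(big_map (reshape_index sh) xpredT (fun k => (k == i) : nat)).
rewrite map_reshape_index big_flatten /= big_map iotaE big_mkord.
under eq_bigr => k _ do rewrite big_nseq iter_addn_0.
case: (ltnP i (size sh)) => [lti|lei].
  rewrite (bigD1 (Ordinal lti)) //= eqxx mul1n big1 ?addn0 // => k.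
  by rewrite -val_eqE /= => /negPf ->.
rewrite nth_default // big1 // => k _.
by rewrite (_ : (k == i :> nat) = false) //; have := ltn_ord k; lia.
Qed.

(** Equal fibre sizes make the two lists of values permutations of each other. *)
Lemma perm_of_map (T : eqType) n (F G : 'I_n -> T) :
  (forall y, \sum_(x < n) (F x == y) = \sum_(x < n) (G x == y)) ->
  exists p : 'S_n, forall x, F x = G (p x).
Proof.
move=> H.
have /tuple_permP[p Ep] : perm_eq [tuple F i | i < n] [tuple G i | i < n].
  apply/allP => y _ /=; apply/eqP.
  have E (F' : 'I_n -> T) : count_mem y [tuple F' i | i < n] = \sum_(x < n) (F' x == y).
    by rewrite -sum1_count big_map big_mkcond big_enum /=; apply: eq_bigr => i _;
        case: eqP.
  by rewrite !E.
exists p => x; have := congr1 (fun s => nth (F x) s x) Ep.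
by rewrite -!(tnth_nth _ [tuple _ | _ < _]) !tnth_mktuple.
Qed.

(** * Double cosets as matrices *)

Section CosetMatrices.
Variables (n : nat) (beta alpha : seq nat).
Hypotheses (sumn_beta : sumn beta = n) (sumn_alpha : sumn alpha = n).
Implicit Types (w s t : 'S_n).
Local Notation f := (reshape_index beta).
Local Notation g := (reshape_index alpha).
Local Notation r := (size beta).
Local Notation c := (size alpha).
Local Notation dcoset w := (young n beta :* w * young n alpha)%g.

Definition cell w i j : nat := \sum_(x < n) ((f x == i) && (g (w x) == j)).

Definition coset_mat w : seq (seq nat) :=
  mkseq (fun i => mkseq (fun j => cell w i j) c) r.

Let ltf (x : 'I_n) : f x < r.
Proof. by apply: reshape_indexP; rewrite sumn_beta. Qed.

Let ltg (x : 'I_n) : g x < c.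
Proof. by apply: reshape_indexP; rewrite sumn_alpha. Qed.

(** Positions are grouped by the block they lie in and the block of their image. *)
Lemma sum_cell w (G : nat -> nat -> nat) :
  \sum_(x < n) G (f x) (g (w x)) = \sum_(i < r) \sum_(j < c) cell w i j * G i j.
Proof.
under [RHS]eq_bigr => i _ do under eq_bigr => j _ do rewrite big_distrl /=.
under [RHS]eq_bigr => i _ do rewrite exchange_big /=.
rewrite exchange_big; apply: eq_bigr => x _.
rewrite (bigD1 (Ordinal (ltf x))) //= (bigD1 (Ordinal (ltg (w x)))) //= !eqxx mul1n.
rewrite big1 => [|j]; last by rewrite -val_eqE /= eq_sym => /negPf ->.
rewrite big1 => [|i]; first by rewrite !addn0.
rewrite -val_eqE /= eq_sym => /negPf ->; exact: big1.
Qed.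

Lemma coset_mat_size w : all (fun x => size x == c) (coset_mat w).
Proof. by apply/allP => x /mapP[i _ ->]; rewrite size_mkseq. Qed.

Lemma coset_mat_margins w : coset_mat w \in margin_mats beta alpha.
Proof.
rewrite mem_margin_mats coset_mat_size /=; apply/andP; split; apply/eqP.
  apply: (@eq_from_nth _ 0); rewrite size_map size_mkseq // => i lti.
  rewrite (nth_map [::]) ?size_mkseq // nth_mkseq // -count_reshape_index sumn_beta.
  rewrite sumnE big_map -/(mkseq _ _) -[iota 0 c]/(iota 0 c) -{1}[c]subn0
      -/(index_iota 0 c) big_mkord.
  rewrite exchange_big; apply: eq_bigr => x _.
  rewrite (bigD1 (Ordinal (ltg (w x)))) //= eqxx andbT big1 ?addn0 // => j.
  by rewrite -val_eqE /= eq_sym => /negPf ->; rewrite andbF.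
apply: (@eq_from_nth _ 0); rewrite size_colsum ?coset_mat_size // => j ltj.
rewrite nth_colsum ?coset_mat_size // -count_reshape_index sumn_alpha.
rewrite big_map -{1}[r]subn0 -/(index_iota 0 r) big_mkord.
under eq_bigr => i _ do rewrite nth_mkseq //.
rewrite exchange_big [RHS](reindex_inj (@perm_inj _ w)); apply: eq_bigr => x _.
rewrite (bigD1 (Ordinal (ltf x))) //= eqxx big1 ?addn0 // => i.
by rewrite -val_eqE /= eq_sym => /negPf ->.
Qed.

(** Equal matrices give a permutation [p] of the positions that matches cells. It preserves the
    blocks of [beta], while [w^-1 * p * w'] preserves those of [alpha]. *)
Lemma coset_mat_eq w w' : coset_mat w = coset_mat w' -> w' \in dcoset w.
Proof.
move=> E; have [|p Hp] := @perm_of_map _ n (fun x => (f x, g (w x))) (fun x =>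
    (f x, g (w' x))).
  case=> i j; under eq_bigr => x _ do rewrite xpair_eqE.
  under [RHS]eq_bigr => x _ do rewrite xpair_eqE.
  rewrite -!/(cell _ i j).
  case: (ltnP i r) => lti; last by rewrite /cell !big1 // => x _;
      rewrite (ltn_eqF (leq_trans (ltf x) lti)).
  case: (ltnP j c) => ltj; last by rewrite /cell !big1 // => x _;
      rewrite (ltn_eqF (leq_trans (ltg _) ltj)) andbF.
  have := congr1 (fun A => nth 0 (nth [::] A i) j) E.
  by rewrite !nth_mkseq.
apply/dcosetP; exists (p^-1)%g, (w^-1 * p * w')%g; split.
- by apply: youngV; apply/youngP => x; have [-> _] := Hp x.
- by apply/youngP => x; rewrite !permM; have [_ <-] := Hp ((w^-1)%g x); rewrite permKV.
- by rewrite !mulgA mulgK mulVg mul1g.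
Qed.

Lemma coset_mat_dcoset w s t : s \in young n beta -> t \in young n alpha ->
  coset_mat (s * w * t)%g = coset_mat w.
Proof.
move=> /youngP Hs /youngP Ht; apply: eq_map => i; apply: eq_map => j.
rewrite [RHS](reindex_inj (@perm_inj _ s)); apply: eq_bigr => x _.
by rewrite !permM Ht Hs.
Qed.

Lemma coset_mat_surj A : A \in margin_mats beta alpha -> exists w, coset_mat w = A.
Proof.
rewrite mem_margin_mats => /and3P[/eqP EA sA /eqP Ec].
have szA : size A = r by rewrite -EA size_map.
have szrow i : i < r -> size (nth [::] A i) = c.
  by move=> lti; apply/eqP; apply: (all_nthP [::] sA); rewrite szA.
pose a i j := nth 0 (nth [::] A i) j.
(* Each cell [(i, j)] is listed as often as the matrix demands. The first coordinates then have the
   multiplicities of the blocks of [beta], the second those of [alpha]; the matching permutations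
   [p] and [q] give [w = p^-1 * q]. *)
pose s := flatten [seq nseq (a ij.1 ij.2) ij | ij <- allpairs pair (iota 0 r) (iota 0 c)].
have iotaE m : iota 0 m = index_iota 0 m by rewrite /index_iota subn0.
have cnt (P : pred (nat * nat)) :
    count P s = \sum_(i < r) \sum_(j < c) a i j * P (val i, val j).
  rewrite count_flatten -map_comp sumnE big_map big_allpairs iotaE big_mkord.
  apply: eq_bigr => i _; rewrite iotaE big_mkord; apply: eq_bigr => j _ /=.
  by rewrite count_nseq mulnC.
have cnt1 i : count (fun p => p.1 == i) s = nth 0 beta i.
  rewrite cnt -[in RHS]EA; case: (ltnP i r) => [lti|lei]; last first.
    rewrite nth_default ?size_map ?szA // big1 // => k _; rewrite big1 // => j _.
    by rewrite (ltn_eqF (leq_trans (ltn_ord k) lei)) muln0.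
  rewrite (nth_map [::]) ?szA // sumnE (big_nth 0) big_mkord szrow //.
  rewrite (bigD1 (Ordinal lti)) //= [X in _ + X]big1 ?addn0 => [|k].
    by apply: eq_bigr => j _; rewrite eqxx muln1.
  by rewrite -val_eqE /= => /negPf ->; apply: big1 => j _; rewrite muln0.
have cnt2 j : count (fun p => p.2 == j) s = nth 0 alpha j.
  rewrite cnt exchange_big -[in RHS]Ec nth_colsum //=; case: (ltnP j c) => [ltj|lej];
      last first.
    rewrite [RHS]big_seq !big1 // => [x /(allP sA)/eqP Ex|k _];
        first by rewrite nth_default ?Ex.
    by rewrite big1 // => i _; rewrite (ltn_eqF (leq_trans (ltn_ord k) lej)) muln0.
  rewrite (bigD1 (Ordinal ltj)) //= [X in _ + X]big1 ?addn0 => [|k].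
    by rewrite (big_nth [::]) szA big_mkord; apply: eq_bigr => i _; rewrite eqxx muln1.
  by rewrite -val_eqE /= => /negPf ->; apply: big1 => i _; rewrite muln0.
have szs : size s = n.
  rewrite -sumn_alpha sumnE (big_nth 0) big_mkord -count_predT cnt exchange_big.
  apply: eq_bigr => j _; rewrite -cnt2 cnt exchange_big /=.
  rewrite [RHS](bigD1 j) //= [X in _ + X]big1 ?addn0 => [|k].
    by apply: eq_bigr => i _; rewrite eqxx.
  by rewrite -val_eqE /= => /negPf ->; apply: big1 => i _; rewrite muln0.
pose S (x : 'I_n) := nth (0, 0) s x.
have cntS (P : pred (nat * nat)) : \sum_(x < n) P (S x) = count P s.
  by rewrite -sum1_count (big_nth (0, 0)) szs big_mkord [RHS]big_mkcond /=;
      apply: eq_bigr => x _; case: (P _).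
have [|p Hp] := @perm_of_map _ n (fun x => (S x).1) (fun x => f x).
  move=> i; rewrite (cntS (fun p => p.1 == i)) cnt1 -count_reshape_index sumn_beta //.
have [|q Hq] := @perm_of_map _ n (fun x => (S x).2) (fun x => g x).
  move=> i; rewrite (cntS (fun p => p.2 == i)) cnt2 -count_reshape_index sumn_alpha //.
exists (p^-1 * q)%g.
apply: (@eq_from_nth _ [::]); rewrite size_mkseq // => i lti; rewrite nth_mkseq //.
apply: (@eq_from_nth _ 0); rewrite size_mkseq ?szrow // => j ltj; rewrite nth_mkseq //.
rewrite /cell (reindex_inj (@perm_inj _ p)) /=.
under eq_bigr => x _ do rewrite permM permK -Hp -Hq.
rewrite (cntS (fun p => (p.1 == i) && (p.2 == j))) cnt.
rewrite (bigD1 (Ordinal lti)) //= (bigD1 (Ordinal ltj)) //= !eqxx muln1.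
rewrite big1 => [|k]; last by rewrite -val_eqE /= => /negPf ->; rewrite ?andbF muln0.
rewrite big1 => [|k]; first by rewrite !addn0.
by rewrite -val_eqE /= => /negPf ->; apply: big1 => l _; rewrite muln0.
Qed.

Lemma cross_inv_mat w : cross_inv beta alpha w = mat_inv c (coset_mat w).
Proof.
rewrite mat_invE ?coset_mat_size // size_mkseq.
(* [G i j] counts the positions in cells strictly below and to the left of [(i, j)]; [sum_cell] is
   then used once for each member of an inverted pair. *)
pose G i j : nat := \sum_(i' < r) \sum_(j' < c) cell w i' j' * ((i < i') && (j' < j)).
transitivity (\sum_(x < n) G (f x) (g (w x))).
  under eq_bigr => x _ do
    rewrite /G -(sum_cell w (fun i' j' => (f x < i') && (j' < g (w x)) : nat)).
  rewrite /cross_inv -sum1_card big_mkcond pair_bigA /=.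
  by apply: eq_bigr => -[x y] _; rewrite inE /=; case: (_ && _).
rewrite sum_cell; apply: eq_bigr => i _.
rewrite [RHS]big_mkcond /=.
under eq_bigr => j _ do rewrite big_distrr /=.
rewrite exchange_big; apply: eq_bigr => i' _ /=; case: ltnP => _; last first.
  by rewrite big1 // => j _; rewrite big1 ?muln0 // => j' _; rewrite muln0.
rewrite (@crossE c) ?nth_mkseq ?size_mkseq //.
apply: eq_bigr => j _; rewrite big_distrr [RHS]big_mkcond /=; apply: eq_bigr => j' _.
by rewrite !nth_mkseq //; case: ltnP; rewrite ?muln1 ?muln0.
Qed.

End CosetMatrices.

(** * The form as a signed sum over matrices *)

Definition mat_form (K : pzRingType) (b g : seq nat) : K :=
  (\sum_(A <- margin_mats b g) (-1) ^+ mat_inv (size g) A)%R.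

(** [coset_mat] induces a bijection from double cosets to matrices and turns minimal length into
    [mat_inv]; without equal totals there are no matrices. *)
Lemma hformE (K : fieldType) (b g : seq nat) : hform K b g = mat_form K b g.
Proof.
rewrite /hform; case: eqP => [Eb|ne]; last first.
  rewrite /mat_form big_seq big1 // => A /margin_mats_sumn; by move/ne.
set n := sumn g in Eb *.
transitivity (\sum_(c in double_cosets n b g) (-1) ^+ mat_inv (size g) (coset_mat b g
    (repr c)) : K)%R.
  apply: eq_bigr => c cin.
  have rc : repr c \in c by case/imsetP: cin => w _ ->;
      apply: mem_repr (dcoset_refl b g w).
  by rewrite (double_coset_lengthE cin rc) (cross_inv_mat Eb erefl).
rewrite -big_enum /= -(big_map (fun c => coset_mat b g (repr c)) xpredT (fun A =>
    (-1) ^+ mat_inv (size g) A : K)%R).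
apply: perm_big; apply: uniq_perm; last 1 first.
- move=> A; apply/mapP/idP => [[c _ ->]|Ain]; first exact: coset_mat_margins.
  have [w Ew] := coset_mat_surj Eb erefl Ain.
  pose c := (young n b :* w * young n g)%g.
  exists c; first by rewrite mem_enum; apply/imsetP; exists w.
  have /dcosetP[s [t [Hs Ht ->]]] := mem_repr w (dcoset_refl b g w).
  by rewrite (coset_mat_dcoset w Hs Ht).
- rewrite map_inj_in_uniq ?enum_uniq // => c c'; rewrite !mem_enum.
  move=> /imsetP[w _ ->] /imsetP[w' _ ->] E.
  have /dcosetP[s [t [Hs Ht Er]]] := mem_repr w (dcoset_refl b g w).
  have /dcosetP[s' [t' [Hs' Ht' Er']]] := mem_repr w' (dcoset_refl b g w').
  rewrite {}Er {}Er' !coset_mat_dcoset // in E.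
  have /dcosetP[u [v [Hu Hv ->]]] := coset_mat_eq Eb erefl E.
  apply/setP => x; apply/dcosetP/dcosetP => -[a [b' [Ha Hb ->]]].
    exists (a * u^-1)%g, (v^-1 * b')%g; rewrite !youngM ?youngV //; split=> //.
    by rewrite !mulgA mulgKV mulgK.
  by exists (a * u)%g, (v * b')%g; rewrite !youngM // !mulgA.
- exact: margin_mats_uniq.
Qed.

(** Inversion of permutations exchanges the two kinds of double cosets, and the pairs counted by
    [cross_inv] correspond by sending [(x, y)] to [(w y, w x)]. *)
Lemma hform_sym (K : fieldType) (b g : seq nat) : hform K b g = hform K g b.
Proof.
rewrite /hform; case: eqP => [Eb|ne]; last by case: eqP => // E; case: ne.
rewrite -Eb eqxx; set n := sumn b.
have dcV b' g' w : ((young n b' :* w * young n g')^-1 = young n g' :* w^-1 * young n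
    b')%g.
  have yV a : ((young n a)^-1 = young n a)%g.
    by apply/setP => x; rewrite mem_invg; apply/idP/idP => /youngV; rewrite ?invgK.
  by rewrite !invMg !yV invg_set1 mulgA.
have dcin b' g' c : (c^-1%g \in double_cosets n b' g') = (c \in double_cosets n g' b').
  apply/imsetP/imsetP => -[w _ E].
    by exists (w^-1)%g => //; rewrite -[c]invgK E dcV.
  by exists (w^-1)%g => //; rewrite E dcV.
rewrite (reindex_inj invg_inj) /=; apply: eq_big => [c|c cin]; first exact: dcin.
have [w wc] : exists w, w \in c^-1%g by case/imsetP: cin => w _ ->; exists w;
    apply: dcoset_refl.
have cin' := cin; rewrite dcin in cin'; have wc' := wc; rewrite mem_invg in wc'.
rewrite (double_coset_lengthE cin wc) (double_coset_lengthE cin' wc').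
congr (_ ^+ _)%R; rewrite /cross_inv.
pose phi (p : 'I_n * 'I_n) := (w p.2, w p.1).
have phi_inj : injective phi by move=> [x y] [x' y'] /= [/perm_inj -> /perm_inj ->].
rewrite -[LHS](card_imset _ phi_inj); congr #|pred_of_set _|.
apply/setP => -[x y]; rewrite -[x](permKV w) -[y](permKV w) (mem_imset _ (_, _)
    phi_inj) !inE /=.
by rewrite !permK andbC.
Qed.

(** * The coproduct *)

Lemma sumn_eq0 s : (sumn s == 0) = all (pred1 0) s.
Proof. by elim: s => //= a s <-; rewrite addn_eq0. Qed.

Lemma sumn0_nseq s : sumn s = 0 -> s = nseq (size s) 0.
Proof. by move/eqP; rewrite sumn_eq0 => /all_pred1P. Qed.

Lemma addvC x y : addv x y = addv y x.
Proof. by elim: x y => [|a x IHx] [|b y] //=;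
    rewrite /addv /= addnC -/(addv _ _) IHx. Qed.

Lemma add0v c x : size x = c -> addv (nseq c 0) x = x.
Proof. by elim: c x => [|c IHc] [|a x] //= [/IHc E]; rewrite /addv /= -/(addv _ _) E. Qed.

Lemma sum_nat_doubles (V : nmodType) (F : nat -> V) m :
  (\sum_(s < m.*2) F s = \sum_(s < m) (F s.*2 + F s.*2.+1))%R.
Proof.
elim: m => [|m IHm]; first by rewrite !big_ord0.
by rewrite doubleS !big_ord_recr /= IHm addrA.
Qed.

Section Splits.
Local Open Scope ring_scope.
Variable V : nmodType.
Implicit Types (g : seq nat).

Lemma splits_cons_sum a g (F : seq nat -> seq nat -> V) :
  \sum_(p <- splits (a :: g)) F p.1 p.2 =
  \sum_(i < a.+1) \sum_(p <- splits g) F (nat_of_ord i :: p.1) ((a - i)%N :: p.2).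
Proof.
rewrite splits_cons big_allpairs_dep -/(index_iota 0 a.+1).
by rewrite -(big_mkord xpredT (fun i => \sum_(p <- splits g) F (i :: p.1) ((a - i)%N
    :: p.2))).
Qed.

Lemma splits_sym g (F : seq nat -> seq nat -> V) :
  \sum_(p <- splits g) F p.1 p.2 = \sum_(p <- splits g) F p.2 p.1.
Proof.
pose sw (p : seq nat * seq nat) := (p.2, p.1).
have swK : involutive sw by case.
rewrite [RHS](eq_bigr (fun p => F (sw p).1 (sw p).2)) //
    -(big_map sw xpredT (fun p => F p.1 p.2)).
apply: perm_big; apply: uniq_perm; rewrite ?(map_inj_uniq (inv_inj swK)) ?splits_uniq
    // => p.
by rewrite -[p in RHS]swK mem_map ?mem_splits 1?eq_sym 1?addvC //; apply: inv_inj.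
Qed.

Lemma splits_sum0 g (F : seq nat -> seq nat -> V) :
  \sum_(p <- splits g | sumn p.1 == 0%N) F p.1 p.2 = F (nseq (size g) 0%N) g.
Proof.
have min : (nseq (size g) 0%N, g) \in splits g.
  by rewrite mem_splits /= size_nseq eqxx add0v /=.
rewrite -big_filter (bigD1_seq (nseq (size g) 0%N, g)) ?filter_uniq ?splits_uniq //=;
    last first.
  by rewrite mem_filter min /= sumn_nseq.
rewrite big_seq_cond big1 ?addr0 // => p;
    rewrite mem_filter => /andP[/andP[/eqP s0 pin] /eqP[]].
have [s1 s2] := size_splits pin; move: pin; rewrite mem_splits => /andP[_ /eqP <-].
by case: p s0 s1 s2 => x y /= /sumn0_nseq -> /=; rewrite size_nseq => sx sy;
    rewrite sx add0v // sy.
Qed.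

(** Both sides run over all triples with i + j + l = a; on the right [d] is i + j. *)
Lemma sum_triangle a (G : nat -> nat -> nat -> V) :
  \sum_(i < a.+1) \sum_(j < (a - i).+1) G i j (a - i - j)%N =
  \sum_(d < a.+1) \sum_(i < d.+1) G i (d - i)%N (a - d)%N.
Proof.
transitivity (\sum_(i < a.+1) \sum_(d < a.+1 | (i <= d)%N) G i (d - i)%N (a - d)%N).
  apply: eq_bigr => i _.
  rewrite -(big_mkord xpredT (fun j => G i j (a - i - j)%N)) -subSn;
      last by rewrite -ltnS.
  rewrite -(big_geq_mkord i a.+1 xpredT (fun d => G i (d - i)%N (a - d)%N)).
  have := big_addn 0 a.+1 i xpredT (fun d => G i (d - i)%N (a - d)%N);
      rewrite add0n => ->.
  by apply: eq_big_nat => j _; rewrite addnK addnC subnDA.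
rewrite (exchange_big_dep xpredT) //=; apply: eq_bigr => d _.
rewrite (big_ord_widen_cond a.+1 xpredT (fun i => G i (d - i)%N (a - d)%N)) //.
Qed.

(** Coassociativity: both sides run over the decompositions of [g] into three vectors. *)
Lemma splits_coassoc g (F : seq nat -> seq nat -> seq nat -> V) :
  \sum_(p <- splits g) \sum_(q <- splits p.2) F p.1 q.1 q.2 =
  \sum_(p <- splits g) \sum_(q <- splits p.1) F q.1 q.2 p.2.
Proof.
elim: g F => [|a g IHg] F; first by rewrite !big_seq1.
rewrite (splits_cons_sum _ _ (fun x y => \sum_(q <- splits y) F x q.1 q.2)).
rewrite (splits_cons_sum _ _ (fun x y => \sum_(q <- splits x) F q.1 q.2 y)).
under eq_bigr => i _.
  under eq_bigr => p _ do rewrite (splits_cons_sum _ _ (fun x y => F (_ :: p.1) x y)).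
  rewrite exchange_big /=.
  under eq_bigr => j _ do rewrite (IHg (fun x y z => F (_ :: x) (_ :: y) (_ :: z))).
  over.
under [RHS]eq_bigr => d _.
  under eq_bigr => p _ do rewrite (splits_cons_sum _ _ (fun x y => F x y (_ :: p.2))).
  rewrite exchange_big /=.
  over.
exact: (sum_triangle a (fun i j l => \sum_(p <- splits g) \sum_(q <- splits p.1)
   F (i :: q.1) (j :: q.2) (l :: p.2))).
Qed.

End Splits.

(** * Row recursion and product rule for the matrix form *)

Section MatrixForm.
Local Open Scope ring_scope.
Variable K : fieldType.
Implicit Types (b g u v : seq nat).
Local Notation mat_form := (@mat_form K).

Lemma mat_form_nil g : mat_form [::] g = (sumn g == 0%N)%:R.
Proof. by rewrite /mat_form /= sumn_eq0; case: ifP; rewrite ?big_nil ?big_seq1. Qed.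

Lemma mat_form_cons (b0 : nat) b g : mat_form (b0 :: b) g =
  \sum_(p <- splits g | sumn p.1 == b0) (-1) ^+ cross p.1 p.2 * mat_form b p.2.
Proof.
rewrite /mat_form big_allpairs_dep big_filter big_seq_cond [RHS]big_seq_cond.
apply: eq_bigr => p /andP[/size_splits[_ s2] _]; rewrite big_distrr /= !big_seq.
apply: eq_bigr => A; rewrite mem_margin_mats s2 => /and3P[_ _ /eqP ->].
by rewrite exprD.
Qed.

Lemma mat_form_cons0 b g : mat_form (0%N :: b) g = mat_form b g.
Proof.
rewrite mat_form_cons (splits_sum0 _ (fun x y => (-1) ^+ cross x y * mat_form b y)).
by rewrite cross_nseq0l mul1r.
Qed.

(** The matrix is cut below the rows [b]. Inversions across the cut depend only on the column sums
    [p.1] and [p.2] of the two pieces, so this expresses multiplication as the adjoint of the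
    super-coproduct. *)
Lemma mat_form_cat b b' g : mat_form (b ++ b') g =
  \sum_(p <- splits g) (-1) ^+ cross p.1 p.2 * (mat_form b p.1 * mat_form b' p.2).
Proof.
elim: b g => [|b0 b IHb] g /=.
  rewrite -[LHS]mat_form_cons0 mat_form_cons [LHS]big_mkcond /=; apply: eq_bigr => p _.
  by rewrite mat_form_nil; case: eqP => _; rewrite ?mul1r ?mul0r ?mulr0.
rewrite mat_form_cons big_mkcond /=.
(* Here [p.1] is the first row, and [q.1], [q.2] are the column sums of the remaining upper rows and
   of the lower rows; coassociativity then joins the first row to the upper ones. *)
transitivity (\sum_(p <- splits g) \sum_(q <- splits p.2)
   (sumn p.1 == b0)%:R * (-1) ^+ (cross p.1 q.1 + cross p.1 q.2 + cross q.1 q.2) *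
   (mat_form b q.1 * mat_form b' q.2)).
  rewrite !big_seq; apply: eq_bigr => p pin; case: eqP => _; last first.
    by rewrite big1 // => q _; rewrite !mul0r.
  rewrite IHb big_distrr /= !big_seq; apply: eq_bigr => q qin.
  have [s1 s2] := size_splits pin; have [s3 s4] := size_splits qin.
  move: (qin); rewrite mem_splits => /andP[_ /eqP <-].
  by rewrite cross_addvr ?s1 ?s3 ?s4 ?s2 // mul1r !exprD !mulrA.
etransitivity; first exact: (splits_coassoc g (fun x y z => (sumn x == b0)%:R *
  (-1) ^+ (cross x y + cross x z + cross y z) * (mat_form b y * mat_form b' z))).
rewrite big_seq [RHS]big_seq; apply: eq_bigr => p pin.
rewrite mat_form_cons big_distrl big_distrr [RHS]big_mkcond /= !big_seq;
    apply: eq_bigr => q qin.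
case: eqP => _; last by rewrite !mul0r.
have [s1 s2] := size_splits pin; have [s3 s4] := size_splits qin.
move: (qin); rewrite mem_splits => /andP[_ /eqP <-].
by rewrite cross_addvl ?s2 ?s3 ?s4 ?s1 // !exprD mul1r; ring.
Qed.

Lemma mat_form_row1 (b0 : nat) g : mat_form [:: b0] g = (sumn g == b0)%:R.
Proof.
rewrite mat_form_cons big_mkcond /= (splits_sym _ (fun x y =>
  if sumn x == b0 then (-1) ^+ cross x y * mat_form [::] y else 0)).
rewrite (eq_bigr (fun p => if sumn p.1 == 0%N then
  (if sumn p.2 == b0 then (-1) ^+ cross p.2 p.1 else 0) else 0)); last first.
  by move=> p _; rewrite mat_form_nil; do 2!case: eqP => _; rewrite ?mulr1 ?mulr0.
rewrite -big_mkcond /= (splits_sum0 _ (fun x y =>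
    if sumn y == b0 then (-1) ^+ cross y x else 0)).
by rewrite cross_nseq0r; case: eqP.
Qed.

(** By the product rule a linear relation between the middle factors survives multiplication on both
    sides: combinatorially, the radical is a two-sided ideal. *)
Lemma mat_form_context (L : seq (K * seq nat)) u v g :
  (forall d, \sum_(l <- L) l.1 * mat_form l.2 d = 0) ->
  \sum_(l <- L) l.1 * mat_form (u ++ l.2 ++ v) g = 0.
Proof.
move=> H.
under eq_bigr => l _ do rewrite mat_form_cat big_distrr /=.
rewrite exchange_big big1 //= => p _.
under eq_bigr => l _ do rewrite mat_form_cat 2!big_distrr /=.
under eq_bigr => l _ do rewrite big_distrr /=.
rewrite exchange_big big1 //= => q _.
transitivity ((-1) ^+ cross p.1 p.2 * mat_form u p.1 * (-1) ^+ cross q.1 q.2 *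
    mat_form v q.2 *
  \sum_(l <- L) l.1 * mat_form l.2 q.1); last by rewrite H mulr0.
by rewrite big_distrr; apply: eq_bigr => l _ /=; ring.
Qed.

Lemma mat_form_zero u v g : mat_form (u ++ 0%N :: v) g = mat_form (u ++ v) g.
Proof. by rewrite !mat_form_cat; apply: eq_bigr => p _; rewrite mat_form_cons0. Qed.

End MatrixForm.

(** * Relations between two generators *)

Section TwoRows.
Local Open Scope ring_scope.
Variable K : fieldType.
Implicit Types (P Q : nat -> nat -> K) (a b i j m : nat) (g : seq nat).
Local Notation mat_form := (@mat_form K).

(* On generating functions, prepending a column of sum a acts as
   sum_(s <= a) Y^(a-s) X^s with XY = -YX.  With U = X^2 and V = Y^2 this is
   (X + Y) h_m(U, V) for a = 2m+1, and h_m(U, V) + YX h_(m-1)(U, V) for a = 2m;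
   [col_op], [shift_op], [step_op] and [diag_op] are the transposes of the whole
   sum, of h_m(U, V), of X + Y and of YX. *)
Definition pair_sum P g : K :=
  \sum_(p <- splits g) (-1) ^+ cross p.1 p.2 * P (sumn p.1) (sumn p.2).

Definition col_op a P i j : K :=
  \sum_(s < a.+1) (-1) ^+ ((a - s) * i) * P (s + i)%N (a - s + j)%N.

Definition shift_op m P i j : K :=
  \sum_(s < m.+1) P (s.*2 + i)%N ((m - s).*2 + j)%N.

Definition step_op P i j : K := P i.+1 j + (-1) ^+ i * P i j.+1.

Definition diag_op P i j : K := (-1) ^+ i * P i.+1 j.+1.

Definition add_op P Q i j : K := P i j + Q i j.

(* The functions orthogonal to the symmetric polynomials in U and V multiplied by
   1, YX, X + Y and (X + Y)YX. *)
Definition annihilator P : Prop :=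
  [/\ forall i j, odd i = odd j -> P i j + P j i = 0,
      forall a b, P a.*2.+1 b.*2 + P a.*2 b.*2.+1 +
                  (P b.*2.+1 a.*2 + P b.*2 a.*2.+1) = 0
    & forall a b, P a.*2.+1 b.*2.+2 - P a.*2.+2 b.*2.+1 +
                  (P b.*2.+1 a.*2.+2 - P b.*2.+2 a.*2.+1) = 0].

Lemma annihilator_ext P Q : (forall i j, P i j = Q i j) ->
  annihilator P -> annihilator Q.
Proof.
move=> E [H1 H2 H3].
by split=> [i j Eij|a b|a b]; rewrite -!E ?H1 ?H2 ?H3.
Qed.

Lemma annihilator_add P Q :
  annihilator P -> annihilator Q -> annihilator (add_op P Q).
Proof.
move=> [H1 H2 H3] [H1' H2' H3']; rewrite /add_op.
split=> [i j Eij|a b|a b].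
- by rewrite addrACA H1 // H1' // addr0.
- by rewrite -[RHS](addr0 0) -{1}(H2 a b) -(H2' a b); ring.
- by rewrite -[RHS](addr0 0) -{1}(H3 a b) -(H3' a b); ring.
Qed.

Lemma shift_op_sym m P i j : \sum_(s < m.+1) P (s.*2 + i)%N ((m - s).*2 + j)%N =
  \sum_(s < m.+1) P ((m - s).*2 + i)%N (s.*2 + j)%N.
Proof.
rewrite (reindex_inj rev_ord_inj); apply: eq_bigr => s _ /=.
by rewrite subSS subKn // -ltnS.
Qed.

(** As h_m(U, V) is symmetric, reversing the sum in the terms with exchanged arguments reduces each
    condition to the one for [P]. *)
Lemma annihilator_shift m P : annihilator P -> annihilator (shift_op m P).
Proof.
move=> [H1 H2 H3]; rewrite /shift_op; split=> [i j Eij|a b|a b].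
- rewrite [X in _ + X]shift_op_sym -big_split big1 //= => s _.
  by apply: H1; rewrite !oddD !odd_double Eij.
- rewrite -big_split (shift_op_sym m P b.*2.+1) (shift_op_sym m P b.*2).
  rewrite -!big_split big1 //= => s _.
  by rewrite !addnS -!doubleD H2.
- rewrite -sumrB (shift_op_sym m P b.*2.+1) (shift_op_sym m P b.*2.+2).
  rewrite -sumrB -!big_split big1 //= => s _.
  by rewrite !addnS -!doubleD H3.
Qed.

Lemma sign_double n : (-1) ^+ n.*2 = 1 :> K.
Proof. by rewrite -signr_odd odd_double. Qed.

Lemma sign_doubleS n : (-1) ^+ n.*2.+1 = -1 :> K.
Proof. by rewrite exprS sign_double mulr1. Qed.

(** Dual to (X + Y)^2 = U + V, which is symmetric: the factor X + Y permutes the four types of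
    elements up to symmetric factors. *)
Lemma annihilator_step P : annihilator P -> annihilator (step_op P).
Proof.
move=> [H1 H2 H3]; rewrite /step_op; split=> [i j Eij|a b|a b].
- rewrite -[i]odd_double_half -[j]odd_double_half -Eij.
  case: (odd i); rewrite ?add1n ?add0n ?sign_double ?sign_doubleS.
    by rewrite -[RHS]oppr0 -(H3 i./2 j./2); ring.
  by rewrite -(H2 i./2 j./2); ring.
- have E1 : P a.*2.+2 b.*2 + P b.*2 a.*2.+2 = 0 by apply: H1; rewrite /= !odd_double.
  have E2 : P a.*2 b.*2.+2 + P b.*2.+2 a.*2 = 0 by apply: H1; rewrite /= !odd_double.
  rewrite !sign_double !sign_doubleS -[RHS](addr0 0) -{1}E1 -E2; ring.
- have E1 : P a.*2.+1 b.*2.+3 + P b.*2.+3 a.*2.+1 = 0 by apply: H1;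
    rewrite /= !odd_double.
  have E2 : P a.*2.+3 b.*2.+1 + P b.*2.+1 a.*2.+3 = 0 by apply: H1;
      rewrite /= !odd_double.
  rewrite -!doubleS !sign_double !sign_doubleS !doubleS -[RHS]oppr0 -[in RHS](addr0
      0) -{1}E1 -E2; ring.
Qed.

(** Dual to the facts that (YX)^2 = -UV is symmetric and that YX anticommutes with X + Y. *)
Lemma annihilator_diag P : annihilator P -> annihilator (diag_op P).
Proof.
move=> [H1 H2 H3]; rewrite /diag_op; split=> [i j Eij|a b|a b].
- by rewrite -(signr_odd K i) Eij signr_odd -mulrDr H1 ?mulr0 //= Eij.
- by rewrite !sign_double !sign_doubleS -(H3 a b); ring.
- rewrite -!doubleS !sign_double !sign_doubleS -[RHS]oppr0 -(H2 a.+1 b.+1) !doubleS; ring.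
Qed.

(** For odd [a] consecutive even and odd indices [s] combine into one factor X + Y; for even [a] the
    even ones give a complete symmetric polynomial in U and V, the odd ones the term with YX. *)
Lemma annihilator_col a P : annihilator P -> annihilator (col_op a P).
Proof.
move=> HP; rewrite -[a]odd_double_half; case: (odd a); rewrite ?add1n ?add0n.
  apply: (annihilator_ext _ (annihilator_step (annihilator_shift a./2 HP))) => i j.
  rewrite /col_op -doubleS.
  rewrite (sum_nat_doubles (fun s => (-1) ^+ ((a./2.*2.+1 - s) * i) * P (s + i)%N
      (a./2.*2.+1 - s + j)%N)) /step_op /shift_op big_distrr -big_split /=.
  apply: eq_bigr => s _; have les : (s <= a./2)%N by rewrite -ltnS.
  have E : ((a./2).*2.+1 - s.*2 = (a./2 - s).*2.+1)%N by rewrite subSn ?doubleB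
      ?leq_double.
  rewrite E subSS -doubleB -doubleMl mulSn exprD -doubleMl !sign_double.
  by rewrite !mul1r mulr1 addrC !addnS !addSn.
move: (a./2) => {a} [|m].
  apply: (annihilator_ext _ HP) => i j.
  by rewrite /col_op double0 big_ord1 mul0n expr0 mul1r.
apply: (annihilator_ext _ (annihilator_add (annihilator_shift m.+1 HP)
   (annihilator_diag (annihilator_shift m HP)))) => i j.
rewrite /col_op [RHS]big_ord_recr /=.
rewrite (sum_nat_doubles (fun s => (-1) ^+ ((m.+1.*2 - s) * i) * P (s + i)%N (m.+1.*2
    - s + j)%N)).
rewrite big_split /= /add_op /diag_op /shift_op big_ord_recr /= [LHS]addrAC;
    congr (_ + _ + _).
- by apply: eq_bigr => s _; rewrite -doubleB -doubleMl sign_double mul1r.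
- rewrite big_distrr; apply: eq_bigr => s _ /=.
  have les : (s <= m)%N by rewrite -ltnS.
  have -> : (m.+1.*2 - s.*2.+1 = (m - s).*2.+1)%N by rewrite doubleS subSS subSn
      ?doubleB ?leq_double.
  by rewrite mulSn exprD -doubleMl sign_double mulr1 !addnS !addSn.
- by rewrite !subnn mul0n expr0 mul1r.
Qed.

Lemma pair_sum_cons P a g : pair_sum P (a :: g) = pair_sum (col_op a P) g.
Proof.
rewrite /pair_sum (splits_cons_sum _ _ (fun x y =>
    (-1) ^+ cross x y * P (sumn x) (sumn y))).
rewrite exchange_big /=; apply: eq_bigr => p _.
rewrite /col_op big_distrr; apply: eq_bigr => s _ /=.
by rewrite exprD mulrCA !mulrA.
Qed.

Hypothesis char_neq2 : 2%:R != 0 :> K.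

Lemma pair_sum_annihilator P g : annihilator P -> pair_sum P g = 0.
Proof.
elim: g P => [|a g IHg] P HP; last by rewrite pair_sum_cons; apply/IHg/annihilator_col.
(* No columns are left and only [P 0 0] remains; the first condition gives 2 P 0 0 = 0, where the
   characteristic matters. *)
rewrite /pair_sum big_seq1 mul1r /=; case: HP => /(_ 0%N 0%N erefl) /eqP H _ _.
by apply/eqP; move: H; rewrite -mulr2n -mulr_natl mulf_eq0 (negPf char_neq2).
Qed.

Definition kron i j (p q : nat) : K := (p == i)%:R * (q == j)%:R.

Lemma mat_form_row2 i j g : mat_form [:: i; j] g = pair_sum (kron i j) g.
Proof. by rewrite (mat_form_cat _ [:: i] [:: j]); apply: eq_bigr => p _;
    rewrite !mat_form_row1. Qed.

Lemma pair_sum_lin (L : seq (K * (nat * nat))) g :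
  \sum_(l <- L) l.1 * pair_sum (kron l.2.1 l.2.2) g =
  pair_sum (fun i j => \sum_(l <- L) l.1 * kron l.2.1 l.2.2 i j) g.
Proof.
under eq_bigr => l _ do rewrite big_distrr /=.
rewrite exchange_big; apply: eq_bigr => p _ /=.
by rewrite big_distrr; apply: eq_bigr => l _ /=; ring.
Qed.

(** Annihilating combinations of the functionals [kron] become relations between two adjacent parts
    in any context [u], [v]. *)
Lemma mat_form_row2_rel (L : seq (K * (nat * nat))) u v g :
  annihilator (fun i j => \sum_(l <- L) l.1 * kron l.2.1 l.2.2 i j) ->
  \sum_(l <- L) l.1 * mat_form (u ++ [:: l.2.1, l.2.2 & v]) g = 0.
Proof.
move=> HL.
have := @mat_form_context K [seq (l.1, [:: l.2.1; l.2.2]) | l <- L] u v g.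
rewrite big_map /=; apply=> d; rewrite big_map /=.
under eq_bigr => l _ do rewrite mat_form_row2.
by rewrite pair_sum_lin pair_sum_annihilator.
Qed.

Lemma kron_parity i j p q : odd (p + q) != odd (i + j) -> kron i j p q = 0.
Proof.
rewrite /kron => ne; case: eqP => [Ep|]; rewrite ?mul0r //.
by case: eqP => [Eq|]; rewrite ?mulr0 //; rewrite Ep Eq eqxx in ne.
Qed.

(** The difference of [kron i j] and [kron j i] is antisymmetric and lives in even total degree,
    where the last two conditions of [annihilator] are vacuous. *)
Lemma mat_form_swap_even i j u v g : ~~ odd (i + j) ->
  mat_form (u ++ [:: i, j & v]) g = mat_form (u ++ [:: j, i & v]) g.
Proof.
move=> Eij; have Eji : ~~ odd (j + i) by rewrite addnC.
have := @mat_form_row2_rel [:: (1, (i, j)); (-1, (j, i))] u v g.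
rewrite !big_cons big_nil /= mul1r mulN1r addr0 => H; apply/eqP; rewrite -subr_eq0;
    apply/eqP.
apply: H; split=> [p q Epq|a b|a b]; rewrite !big_cons !big_nil /=;
    first by rewrite /kron; ring.
  rewrite !kron_parity ?(negPf Eij) ?(negPf Eji) ?oddD /= ?odd_double //; ring.
rewrite !kron_parity ?(negPf Eij) ?(negPf Eji) ?oddD /= ?odd_double //; ring.
Qed.

(** In odd total degree the first condition is vacuous; the other two compare Kronecker deltas once
    the common parity of [i] and [j] is fixed. *)
Lemma mat_form_swap_odd i j u v g : odd (i + j.+1) ->
  mat_form (u ++ [:: i, j.+1 & v]) g + (-1) ^+ i * mat_form (u ++ [:: j.+1, i & v]) g =
  (-1) ^+ i * mat_form (u ++ [:: i.+1, j & v]) g + mat_form (u ++ [:: j, i.+1 & v]) g.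
Proof.
move=> Eij.
have := @mat_form_row2_rel [:: (1, (i, j.+1)); ((-1) ^+ i, (j.+1, i));
    (- (-1) ^+ i, (i.+1, j)); (-1, (j, i.+1))] u v g.
rewrite !big_cons big_nil /= mul1r mulN1r addr0 => H.
apply/eqP; rewrite -subr_eq0; apply/eqP; rewrite -[RHS]H; first by ring.
have dbl x y : (x.*2 == y.*2) = (x == y) := inj_eq double_inj x y.
have dblF x y : (x.*2.+1 == y.*2) = false by apply/eqP => /(congr1 odd);
    rewrite /= !odd_double.
have dblF' x y : (x.*2 == y.*2.+1) = false by rewrite eq_sym.
split=> [p q Epq|a b|a b]; rewrite !big_cons !big_nil /=.
  have E : odd (p + q) = false by rewrite oddD Epq addbb.
  have E' : odd (q + p) = false by rewrite addnC.
  have Eji : odd (j.+1 + i) by rewrite addnC.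
  have E1 : odd (i.+1 + j) by rewrite addSnnS.
  have E2 : odd (j + i.+1) by rewrite addnC.
  by rewrite !kron_parity ?E ?E' ?Eij ?Eji ?E1 ?E2 //; ring.
all: have {}Eij : odd j = odd i by move: Eij; rewrite oddD /=; case: (odd i);
    case: (odd j).
all: rewrite -[i]odd_double_half -[j]odd_double_half Eij; move: (i./2) (j./2) => i' j'.
all: case: (odd i); rewrite ?add1n ?add0n ?sign_double ?sign_doubleS /kron ?eqSS
    -?doubleS ?dblF ?dblF' ?dbl ?eqSS ?dblF ?dblF' ?dbl; ring.
Qed.
End TwoRows.

(** * Straightening *)

Lemma adjacent_ascent (s : seq nat) : ~~ sorted geq s ->
  exists u i j v, s = u ++ [:: j, i & v] /\ j < i.
Proof.
elim: s => [|a [|b s] IHs] //=; case: (leqP b a) => [leba|ltab] /=.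
  by move=> /IHs[u [i [j [v [E ltji]]]]]; exists (a :: u), i, j, v; rewrite E.
by move=> _; exists [::], b, a, s.
Qed.

(* Decreases when an adjacent pair (j, i) is replaced by (i + t, j - t) with j < i. *)
Fixpoint weight (s : seq nat) : nat := if s is _ :: s' then sumn s' + weight s' else 0.

Lemma weight_cat u v : weight (u ++ v) = weight u + size u * sumn v + weight v.
Proof. by elim: u => [|a u IHu] //=; rewrite IHu sumn_cat mulSn; lia. Qed.

Section Straightening.
Local Open Scope ring_scope.
Variables (K : fieldType) (phi : seq nat -> K) (k : nat).
Hypothesis k_even : ~~ odd k.
Hypothesis phi_zero : forall u v, phi (u ++ 0%N :: v) = phi (u ++ v).
Hypothesis phi_even : forall i j u v, ~~ odd (i + j) ->
  phi (u ++ [:: i, j & v]) = phi (u ++ [:: j, i & v]).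
Hypothesis phi_odd : forall i j u v, odd (i + j.+1) ->
  phi (u ++ [:: i, j.+1 & v]) + (-1) ^+ i * phi (u ++ [:: j.+1, i & v]) =
  (-1) ^+ i * phi (u ++ [:: i.+1, j & v]) + phi (u ++ [:: j, i.+1 & v]).
Hypothesis phi_part : forall l, is_part k l -> (1 < size l)%N -> phi l = 0.

(** Induction on [j]: in the odd relation three of the four terms vanish by hypothesis or induction,
    and the remaining one carries only a sign. At [j = 0] the zero can be moved across. *)
Lemma phi_pair0 u v i j : (j <= i)%N -> odd (i + j) ->
  (forall a b, (b < a)%N -> (i <= a)%N -> (a + b = i + j)%N ->
     phi (u ++ [:: a, b & v]) = 0) ->
  phi (u ++ [:: j, i & v]) = 0.
Proof.
elim: j i => [|j IHj] i leji Eij H.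
  have i_gt0 : (0 < i)%N by case: i Eij {leji H}.
  rewrite phi_zero; have := H i 0%N i_gt0 (leqnn i) erefl.
  by have := phi_zero (u ++ [:: i]) v; rewrite -!catA /= => ->.
have ltji : (j.+1 < i)%N.
  by rewrite ltn_neqAle leji andbT; apply: contraTneq Eij => ->; rewrite addnn odd_double.
have E1 : phi (u ++ [:: i, j.+1 & v]) = 0 by apply: H.
have E2 : phi (u ++ [:: i.+1, j & v]) = 0 by apply: H => //; lia.
have E3 : phi (u ++ [:: j, i.+1 & v]) = 0.
  apply: IHj => [||a b ltba lea E]; [lia | by rewrite addSnnS | apply: H => //; lia].
have := phi_odd u v Eij; rewrite E1 E2 E3 mulr0 !add0r => /eqP.
by rewrite mulf_eq0 signr_eq0 => /eqP.
Qed.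

Lemma phi_straighten b : 0%N \notin b -> sumn b = k -> (1 < size b)%N -> phi b = 0.
Proof.
have [n] := ubnP (weight b); elim: n b => // n IHn b ltn b_pos sb size_b.
case: (boolP (sorted geq b)) => [b_sorted|/adjacent_ascent[u [i [j [v [Eb ltji]]]]]].
  by apply: phi_part; rewrite // /is_part b_sorted b_pos sb eqxx.
rewrite {}Eb in ltn b_pos sb size_b *.
move: b_pos; rewrite mem_cat !inE !negb_or => /and4P[u_pos j_pos i_pos v_pos].
(* Moving degree to the left of the pair lowers the weight, so the induction hypothesis applies as
   long as no part becomes zero. *)
have small a c : (j < a)%N -> (a + c = i + j)%N -> (0 < c)%N ->
    phi (u ++ [:: a, c & v]) = 0.
  move=> ltja E c_gt0; apply: IHn.
  - by move: ltn; rewrite !weight_cat /=; lia.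
  - rewrite mem_cat !inE !negb_or u_pos v_pos andbT /=; lia.
  - by rewrite -sb !sumn_cat /=; lia.
  - by move: size_b; rewrite !size_cat.
case: (boolP (odd (i + j))) => [odd_ij|even_ij]; last first.
  by rewrite phi_even 1?addnC //; apply: small => //; rewrite lt0n eq_sym.
apply: phi_pair0 => // [|a c ltca leia E]; first exact: ltnW.
case: (posnP c) => [c0|c_gt0]; last by apply: small => //; lia.
rewrite c0 addn0 in E *.
have := phi_zero (u ++ [:: a]) v; rewrite -!catA /= => ->.
apply: IHn.
- by move: ltn; rewrite !weight_cat /=; lia.
- rewrite mem_cat !inE !negb_or u_pos v_pos andbT /=; lia.
- by rewrite -sb !sumn_cat /=; lia.
(* When the pair merges into the single part [i + j], at least two parts survive: otherwise
   [k = i + j], but [i + j] is odd and [k] even. *)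
- apply: contraNT k_even; rewrite -leqNgt size_cat /= => le1.
  have u0 : u = [::] by apply: size0nil; lia.
  have v0 : v = [::] by apply: size0nil; lia.
  by rewrite -sb u0 v0 /= addn0 addnC.
Qed.

End Straightening.

(** * Descent to the quotient *)

Section Pairing.
Local Open Scope ring_scope.
Local Open Scope quotient_scope.
Variable K : fieldType.
Implicit Types (f : free_odd_sym K) (g b : seq nat).
Local Notation mat_form := (@mat_form K).
Local Notation comp := comp_of_word.
Local Notation form := Defs.form.
Local Notation qrepr := generic_quotient.repr.

Lemma mat_form_sym b g : mat_form b g = mat_form g b.
Proof. by rewrite -!hformE hform_sym. Qed.

Lemma mat_form_filter b g : mat_form [seq a <- b | a != 0%N] g = mat_form b g.
Proof.
suff H u : mat_form (u ++ [seq a <- b | a != 0%N]) g = mat_form (u ++ b) g by exact: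
    H [::].
elim: b u => [|a b IHb] u //=; case: eqP => [->|_] /=; first by rewrite mat_form_zero.
by rewrite -!cat_rcons IHb.
Qed.

Lemma mat_form_neq b g : sumn b <> sumn g -> mat_form b g = 0.
Proof. by rewrite -hformE /hform => /eqP/negPf ->. Qed.

(** The form of [f] with h_g, additive in [f]; allowing zero parts in [g] lets all splittings of a
    composition be inserted directly. *)
Definition pairing f g : K := mmap idfun (fun u => mat_form (comp u) g) f.

Lemma pairingE f g : pairing f g = \sum_(u <- msupp f) f@_u * mat_form (comp u) g.
Proof. by rewrite /pairing mmapE. Qed.

Lemma pairingB f1 f2 g : pairing (f1 - f2) g = pairing f1 g - pairing f2 g.
Proof. exact: raddfB. Qed.

Lemma pairing_word u g : pairing << u >> g = mat_form (comp u) g.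
Proof. by rewrite /pairing mmapU mul1r. Qed.

Lemma pairing_filter f g : pairing f [seq a <- g | a != 0%N] = pairing f g.
Proof.
by rewrite !pairingE; apply: eq_bigr => u _;
    rewrite mat_form_sym mat_form_filter mat_form_sym.
Qed.

Lemma form_pairing f f' : form f f' = \sum_(v <- msupp f') f'@_v * pairing f (comp v).
Proof.
rewrite /form exchange_big; apply: eq_bigr => v _; rewrite pairingE big_distrr /=.
by apply: eq_bigr => u _; rewrite hformE; ring.
Qed.

Lemma form_sym f f' : form f f' = form f' f.
Proof.
rewrite /form exchange_big; apply: eq_bigr => v _; apply: eq_bigr => u _.
by rewrite hform_sym mulrAC mulrC mulrA mulrAC.
Qed.

Lemma comp_surj g : 0%N \notin g -> exists u : {fmonom nat}, comp u = g.
Proof.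
move=> g0; exists (FMonom [seq a.-1 | a <- g]); rewrite /comp /= -map_comp.
rewrite -[RHS]map_id; apply/eq_in_map => a /= ag; rewrite prednK // lt0n.
by apply: contraNneq g0 => <-.
Qed.

(** By linearity it is enough to test against words; zero parts of [g] are dropped first because
    words only produce positive parts. *)
Lemma radicalP f : f \in @radical K <-> forall g, pairing f g = 0.
Proof.
split=> [/asboolP H g|H]; last first.
  by apply/asboolP => f'; rewrite form_pairing big1 // => v _; rewrite H mulr0.
rewrite -pairing_filter; have [|u <-] := @comp_surj [seq a <- g | a != 0%N].
  by rewrite mem_filter eqxx.
have := H << u >>; rewrite form_pairing msuppU1 big_seq_fset1 mcoeffUU mul1r //.
Qed.

(** Bilinear extension of [mat_form_cat], and the reason why the radical is a two-sided ideal. *)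
Lemma pairing_mul f f' g : pairing (f * f') g =
  \sum_(p <- splits g) (-1) ^+ cross p.1 p.2 * (pairing f p.1 * pairing f' p.2).
Proof.
rewrite malgME /pairing raddf_sum /=.
under eq_bigr => u _ do rewrite raddf_sum /=.
under eq_bigr => u _ do under eq_bigr => v _ do rewrite mmapU /= /comp fmM map_cat
    mat_form_cat big_distrr /=.
under eq_bigr => u _ do rewrite exchange_big /=.
rewrite exchange_big; apply: eq_bigr => p _ /=; rewrite !mmapE.
rewrite big_distrl big_distrr; apply: eq_bigr => u _ /=.
rewrite big_distrr big_distrr; apply: eq_bigr => v _ /=.
by rewrite /comp; ring.
Qed.

Lemma radicalMl f f' : f \in @radical K -> f * f' \in @radical K.
Proof.
move=> /radicalP H; apply/radicalP => g.
by rewrite pairing_mul big1 // => p _; rewrite H mul0r mulr0.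
Qed.

Lemma radicalMr f f' : f \in @radical K -> f' * f \in @radical K.
Proof.
move=> /radicalP H; apply/radicalP => g.
by rewrite pairing_mul big1 // => p _; rewrite H mulr0 mulr0.
Qed.

Lemma pi_eqP f f' : \pi_(odd_sym K) f = \pi_(odd_sym K) f' <-> f - f' \in @radical K.
Proof. by rewrite Quotient.idealrBE; split=> [->|/eqP]. Qed.

Lemma repr_radical f : qrepr (\pi_(odd_sym K) f) - f \in @radical K.
Proof. by apply/pi_eqP; rewrite reprK. Qed.

Lemma mulL_pi f f' : mulL (\pi_(odd_sym K) f) (\pi_(odd_sym K) f') = \pi_(odd_sym K)
    (f * f').
Proof.
rewrite /mulL -lock; apply/pi_eqP; set a := qrepr _; set a' := qrepr _.
have -> : a * a' - f * f' = (a - f) * a' + f * (a' - f').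
  by rewrite mulrBl mulrBr addrA subrK.
by apply: rpredD; [apply: radicalMl | apply: radicalMr]; apply: repr_radical.
Qed.

Lemma form_radical f1 f2 f' : f1 - f2 \in @radical K -> form f1 f' = form f2 f'.
Proof.
move=> /radicalP H; rewrite !form_pairing; apply: eq_bigr => v _.
by apply/eqP; rewrite -subr_eq0 -mulrBr -pairingB H mulr0.
Qed.

Lemma formL_pi f f' : formL (\pi_(odd_sym K) f) (\pi_(odd_sym K) f') = form f f'.
Proof.
rewrite /formL -lock (form_radical _ (repr_radical f)) form_sym.
by rewrite (form_radical _ (repr_radical f')) form_sym.
Qed.

Lemma pairing1 g : pairing 1 g = mat_form [::] g.
Proof.
have -> : 1 = << (mone : {fmonom nat}) >> :> free_odd_sym K.
  by apply/malgP => u; rewrite mcoeff1.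
by rewrite pairing_word /comp fm1.
Qed.

Lemma pairing_h a g : pairing (h K a) g = mat_form [:: a] g.
Proof.
case: a => [|a] /=; last by rewrite pairing_word /comp fmU.
by rewrite /pairing mmap1 /= || rewrite pairing1 mat_form_cons0.
Qed.

Lemma pairing_h_comp b g : pairing (h_comp K b) g = mat_form b g.
Proof.
elim: b g => [|a b IHb] g; rewrite /h_comp ?big_nil ?big_cons.
  exact: pairing1.
rewrite pairing_mul (mat_form_cat _ [:: a]); apply: eq_bigr => p _.
by rewrite pairing_h -IHb.
Qed.

Lemma form_h_comp b f : form (h_comp K b) f = pairing f b.
Proof.
rewrite form_pairing pairingE; apply: eq_bigr => v _.
by rewrite pairing_h_comp mat_form_sym.
Qed.

(** The quotient form is nondegenerate, so equality of two products is detected by their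
    pairings. *)
Lemma centralL_pi f : centralL (\pi_(odd_sym K) f) <->
  forall f' g, pairing (f * f') g = pairing (f' * f) g.
Proof.
split=> [H f' g|H y].
  have := H (\pi_(odd_sym K) f'); rewrite !mulL_pi => /pi_eqP/radicalP/(_ g).
  by rewrite pairingB => /eqP; rewrite subr_eq0 => /eqP.
rewrite -[y]reprK !mulL_pi; apply/pi_eqP/radicalP => g.
by rewrite pairingB; apply/eqP; rewrite subr_eq0; apply/eqP; apply: H.
Qed.

End Pairing.

(** * Centrality *)

Section PowerSum.
Local Open Scope ring_scope.
Variables (K : fieldType) (k : nat) (f : free_odd_sym K).
Hypothesis char_neq2 : 2%:R != 0 :> K.
Hypothesis homog_f : homog k f.
Hypothesis pairing_part : forall l, is_part k l -> pairing f l = (l == [:: k])%:R.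

Lemma pairing_homog g : sumn g <> k -> pairing f g = 0.
Proof.
move=> ne; rewrite pairingE big_seq big1 // => u /homog_f Eu.
by rewrite mat_form_neq ?mulr0 // Eu => E; apply: ne.
Qed.

(** Symmetry of the form moves relations between products of generators into the second argument of
    [pairing f]. *)
Lemma pairing_lin (L : seq (K * seq nat)) :
  (forall g, \sum_(l <- L) l.1 * mat_form K l.2 g = 0) ->
  \sum_(l <- L) l.1 * pairing f l.2 = 0.
Proof.
move=> H; under eq_bigr => l _ do rewrite pairingE big_distrr /=.
rewrite exchange_big big1 //= => u _.
transitivity (f@_u * \sum_(l <- L) l.1 * mat_form K l.2 (comp_of_word u));
    last by rewrite H mulr0.
by rewrite big_distrr; apply: eq_bigr => l _ /=; rewrite mat_form_sym; ring.
Qed.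

(** As [k] is even, a composition of [k] with an odd part has at least two parts, so straightening
    applies; other degrees vanish by homogeneity. *)
Lemma pairing_even g : ~~ odd k -> has odd g -> pairing f g = 0.
Proof.
move=> k_even odd_g; rewrite -pairing_filter.
set b := [seq _ <- _ | _].
have b_pos : 0%N \notin b by rewrite mem_filter eqxx.
have odd_b : has odd b.
  case/hasP: odd_g => a ag odd_a; apply/hasP; exists a => //.
  by rewrite mem_filter ag andbT; case: a odd_a {ag}.
have [sb|/eqP ne] := eqVneq (sumn b) k; last exact: pairing_homog.
apply: (@phi_straighten _ (pairing f) k k_even) => //.
- by move=> u v; rewrite -pairing_filter -[RHS]pairing_filter !filter_cat.
- move=> i j u v Eij; apply/eqP; rewrite -subr_eq0; apply/eqP.
  have := pairing_lin (L := [:: (1, u ++ [:: i, j & v]); (-1, u ++ [:: j, i & v])]).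
  rewrite !big_cons big_nil /= mul1r mulN1r addr0; apply=> d.
  by rewrite !big_cons big_nil /= (mat_form_swap_even char_neq2 u v d Eij); ring.
- move=> i j u v Eij; apply/eqP; rewrite -subr_eq0; apply/eqP.
  have := pairing_lin (L := [:: (1, u ++ [:: i, j.+1 & v]);
      ((-1) ^+ i, u ++ [:: j.+1, i & v]);
    (- (-1) ^+ i, u ++ [:: i.+1, j & v]); (-1, u ++ [:: j, i.+1 & v])]).
  rewrite !big_cons big_nil /= => H; rewrite -[RHS]H; first by ring.
  move=> d; rewrite !big_cons big_nil /= addr0;
      have := mat_form_swap_odd char_neq2 u v d Eij.
  move/eqP; rewrite -subr_eq0 => /eqP <-; ring.
- move=> l lP size_l; rewrite pairing_part //; case: eqP size_l => // ->.
  by [].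
- case: b odd_b sb {b_pos} => [|a [|c b]] //=; rewrite addn0 orbF => odd_a Ea.
  by rewrite -Ea odd_a in k_even.
Qed.

Lemma even_sum_even x : ~~ has odd x -> ~~ odd (sumn x).
Proof. by elim: x => //= a x IHx; rewrite negb_or oddD => /andP[/negPf -> /IHx]. Qed.

Lemma even_cross x y : ~~ has odd x -> ~~ odd (cross x y) && ~~ odd (cross y x).
Proof.
elim: x y => [|a x IHx] [|b y] //=; rewrite negb_or => /andP[/negPf Ea ex].
have /andP[/negPf c1 /negPf c2] := IHx y ex.
by rewrite !oddD !oddM c1 c2 Ea (negPf (even_sum_even ex)) !andbF.
Qed.

(** [splits_sym] aligns the two expansions term by term. A term with an odd entry in [p.1] vanishes;
    otherwise all entries of [p.1] are even and both signs are 1. *)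
Lemma even_central : ~~ odd k -> centralL (\pi_(odd_sym K)%qT f).
Proof.
move=> k_even; apply/centralL_pi => f' g; rewrite [LHS]pairing_mul [RHS]pairing_mul.
rewrite (splits_sym g (fun x y => (-1) ^+ cross x y * (pairing f' x * pairing f y))).
apply: eq_bigr => p _; have [odd_p|even_p] := boolP (has odd p.1).
  by rewrite pairing_even // !(mul0r, mulr0).
have /andP[/negPf c1 /negPf c2] := even_cross p.2 even_p.
by rewrite -(signr_odd K (cross p.1 _)) -(signr_odd K (cross p.2 _)) c1 c2 [pairing f
    _ * _]mulrC.
Qed.

(** The part 1 goes either to the second factor, without sign, or to the first, where it passes the
    entry [a - i] of the second. *)
Lemma pairing_mulr_h a c : pairing (f * h K c) [:: a; 1]%N =
  \sum_(i < a.+1) (pairing f [:: val i; 0]%N * (a - i + 1 == c)%N%:R +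
                   (-1) ^+ (a - i) * (pairing f [:: val i; 1]%N * (a - i == c)%N%:R)).
Proof.
rewrite pairing_mul; under eq_bigr => p _ do rewrite pairing_h mat_form_row1.
rewrite (splits_cons_sum _ _ (fun x y => (-1) ^+ cross x y * (pairing f x * (sumn y
    == c)%:R))).
apply: eq_bigr => i _.
rewrite (splits_cons_sum _ _ (fun x y => (-1) ^+ cross (_ :: x) (_ :: y) * (pairing f
    (_ :: x) * (sumn (_ :: y) == c)%:R))).
rewrite !big_ord_recl big_ord0 !big_seq1 addr0 /= !addn0.
by rewrite muln0 muln1 expr0 mul1r.
Qed.

Lemma pairing_mull_h a c : pairing (h K c * f) [:: a; 1]%N =
  \sum_(i < a.+1) ((val i == c)%:R * pairing f [:: a - i; 1]%N +
                   (-1) ^+ (a - i) * ((i + 1 == c)%N%:R * pairing f [:: a - i; 0]%N)).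
Proof.
rewrite pairing_mul; under eq_bigr => p _ do rewrite pairing_h mat_form_row1.
rewrite (splits_cons_sum _ _ (fun x y => (-1) ^+ cross x y * ((sumn x == c)%:R *
    pairing f y))).
apply: eq_bigr => i _.
rewrite (splits_cons_sum _ _ (fun x y => (-1) ^+ cross (_ :: x) (_ :: y) * ((sumn (_
    :: x) == c)%:R * pairing f (_ :: y)))).
rewrite !big_ord_recl big_ord0 !big_seq1 addr0 /= !addn0.
by rewrite muln0 muln1 expr0 mul1r.
Qed.

Lemma pairing_k0 : (0 < k)%N -> pairing f [:: k; 0]%N = 1.
Proof.
move=> k_gt0; rewrite -pairing_filter /= -lt0n k_gt0.
by rewrite pairing_part ?eqxx // /is_part /= inE addn0 eqxx eq_sym -lt0n k_gt0.
Qed.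

Lemma odd_not_central : odd k -> ~ centralL (\pi_(odd_sym K)%qT f).
Proof.
move=> k_odd /centralL_pi H; have k_gt0 : (0 < k)%N by case: k k_odd.
have fk := pairing_k0 k_gt0.
move/eqP: char_neq2; apply; case: (ltnP 1 k) => [k_gt1|k_le1]; last first.
  (* Here [f] is a multiple of h_1 and commutes with it, so h_2 is used instead; the two products
     pair with [[:: 2; 1]] to 2 and 0. *)
  have k1 : k = 1%N by lia.
  have f01 : pairing f [:: 0; 1]%N = 1.
    by rewrite -fk k1 -pairing_filter -[RHS]pairing_filter.
  have := H (h K 2) [:: 2; 1]%N; rewrite [LHS]pairing_mulr_h [RHS]pairing_mull_h.
  rewrite k1 in fk; rewrite !big_ord_recl !big_ord0 /= f01 fk => E.
  by move/eqP: E; rewrite -subr_eq0 => /eqP <-; ring.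
(* For [k > 1] this composition is a partition different from [[:: k]]; with its pairing gone, the
   two products pair with [[:: k; 1]] to 1 and (-1)^k = -1. *)
have fk1 : pairing f [:: k.-1; 1]%N = 0.
  rewrite pairing_part; first by rewrite eqseq_cons andbF.
  by rewrite /is_part /= !inE /=; lia.
have := H (h K 1) [:: k; 1]%N; rewrite [LHS]pairing_mulr_h [RHS]pairing_mull_h.
rewrite (bigD1 ord_max) //= subnn [X in _ + X = _]big1 => [|i]; last first.
  rewrite -val_eqE /= => ne; have ltik : (i < k)%N by rewrite ltn_neqAle ne -ltnS ltn_ord.
  have -> : (k - i + 1 == 1)%N = false by lia.
  have [Ei|Ei] := eqVneq (i : nat) k.-1; first by rewrite Ei fk1 !mul0r !mulr0 addr0.
  have -> : (k - i == 1)%N = false by lia.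
  by rewrite !mulr0 addr0.
rewrite (bigD1 ord0) //= subn0 [X in _ = _ + X]big1 => [|i]; last first.
  rewrite -val_eqE /= => ne; have -> : (i + 1 == 1)%N = false by lia.
  have [Ei|Ei] := eqVneq (i : nat) 1%N; first by rewrite Ei subn1 fk1 !mulr0 mul0r
      mulr0 addr0.
  by rewrite !mul0r mulr0 addr0.
rewrite fk -(signr_odd K k) k_odd /= => E.
by move/eqP: E; rewrite -subr_eq0 => /eqP <-; ring.
Qed.

End PowerSum.

Theorem proposition3p4 (K : fieldType) (charK0 : [pchar K]%R =i pred0)
    (m : seq nat -> odd_sym K) (m_dual : is_dual_basis m)
    (k : nat) (k_ge1 : 1 <= k) :
  centralL (m [:: k]) <-> ~~ odd k.
Proof.
have char_neq2 : (2%:R != 0 :> K)%R by have := charK0 2; rewrite !inE /= => ->.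
have k_part : is_part k [:: k] by rewrite /is_part /= inE addn0 eqxx eq_sym -lt0n k_ge1.
(* [f] is a homogeneous representative of [m [:: k]] in the free algebra; duality determines its
   pairings with all partitions of [k]. *)
have [[f homog_f Ef] m_form] := m_dual k [:: k] k_part.
have pairing_part l : is_part k l -> pairing f l = (l == [:: k])%:R%R.
  by move=> /m_form; rewrite Ef formL_pi form_h_comp.
rewrite Ef; split=> [central|]; last exact: even_central.
by apply/negP => k_odd; exact: (odd_not_central char_neq2 pairing_part k_odd central).
Qed.
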